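(* Let $p\ge5$ be a prime. Consider the set $\mathcal{R}^*$ of all groups $\langle s,r,A\rangle$ and $\langle s, r z_{2^{n+1}}, A\rangle$, where $A$ ranges over the finite subgroups of $\mathrm{D}(p,\mathbb{C})$ that are invariant under conjugation by $\mathrm{Sym}(p)$ and are not contained in the group of scalar matrices, and $2^n=|A\cap Z_{\{2\}}|$. Then every group in $\mathcal{R}^*$ is a finite irreducible subgroup of $\mathrm{M}(p,\mathbb{C})$ with permutation part $\mathrm{Sym}(p)$; every finite irreducible subgroup of $\mathrm{M}(p,\mathbb{C})$ with permutation part $\mathrm{Sym}(p)$ is $\mathrm{GL}(p,\mathbb{C})$-conjugate to a group in $\mathcal{R}^*$; and no two distinct groups in $\mathcal{R}^*$ are $\mathrm{GL}(p,\mathbb{C})$-conjugate.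
   Context: $\mathrm{M}(p,\mathbb{C})$ is the group of monomial matrices, $\mathrm{D}(p,\mathbb{C})$ the invertible diagonal matrices, and $\mathrm{Sym}(p)$ is identified with the permutation matrices via $\alpha\mapsto[\delta_{i\alpha,j}]_{i,j}$. The permutation part of $G\le \mathrm{M}(p,\mathbb{C})$ is its image under $dt\mapsto t$ ($d$ diagonal, $t$ a permutation matrix). $s$ is the permutation matrix of $(1,2,\ldots,p)$ and $r$ that of the transposition $(1,2)$. $z_m$ denotes the scalar matrix $e^{2\pi i/m}I_p$, and $Z_{\{2\}}$ the group of scalar matrices of $2$-power order. *)

(* Defs.v *)
(* The complex numbers are  C := R[i]  with R the
   (Stdlib) classical real numbers, which are an rcfType via Rstruct. *)
From HB Require Import structures.
From Stdlib Require Import Reals.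
From mathcomp Require Import all_boot all_order all_algebra all_fingroup.
From mathcomp Require Import complex Rstruct.
Set Implicit Arguments.
Unset Strict Implicit.
Unset Printing Implicit Defensive.
Import Order.TTheory GRing.Theory Num.Theory.
Local Open Scope ring_scope.

Notation CC := (complex R).

Definition mxset (p : nat) := 'M[CC]_p -> Prop.

Section Defs.
Variable p : nat.
Local Notation M := 'M[CC]_p.

Definition is_subgroup (G : mxset p) : Prop :=
  [/\ G 1%:M,
      (forall g, G g -> g \in unitmx),
      (forall g h, G g -> G h -> G (g *m h)) &
      (forall g, G g -> G (invmx g))].

Definition is_finite (G : mxset p) : Prop :=
  exists s : seq M, forall g, G g <-> g \in s.

Definition has_card (G : mxset p) (k : nat) : Prop :=
  exists s : seq M, [/\ uniq s, size s = k & forall g, G g <-> g \in s].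

Definition same_set (G H : mxset p) : Prop := forall g, G g <-> H g.

(* Sym(p) embedded via alpha |-> [delta_{i alpha, j}]_{i,j}; mathcomp's
   perm_mx s has (i,j)-entry (s i == j)%:R, which is exactly this. *)
Definition monomial_with (g : M) (sigma : 'S_p) : Prop :=
  exists d : 'rV[CC]_p, (forall i, d 0 i != 0) /\ g = diag_mx d *m perm_mx sigma.

Definition monomial (g : M) : Prop := exists sigma, monomial_with g sigma.

Definition diagonal (g : M) : Prop :=
  exists d : 'rV[CC]_p, (forall i, d 0 i != 0) /\ g = diag_mx d.

Definition in_perm_part (G : mxset p) (sigma : 'S_p) : Prop :=
  exists g, G g /\ monomial_with g sigma.

(* irreducible: no G-invariant subspace of C^p other than 0 and C^p
   (subspaces = row spaces, G acting on row vectors on the right) *)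
Definition irreducible_set (G : mxset p) : Prop :=
  forall U : M, (forall g, G g -> (U *m g <= U)%MS) ->
    U = 0 \/ row_full U.

Definition gl_conjugate (G H : mxset p) : Prop :=
  exists P : M, P \in unitmx /\
    forall h, H h <-> G (P *m h *m invmx P).

Definition generated (S : mxset p) : mxset p :=
  fun g => exists l : seq M,
    (forall x, x \in l -> S x \/ S (invmx x)) /\ g = foldr mulmx 1%:M l.

Definition Z2 (g : M) : Prop :=
  exists (a : CC) (k : nat), g = a%:M /\ a ^+ (2 ^ k) = 1.

(* s = permutation matrix of the p-cycle (1,2,...,p), i.e. i |-> i+1 mod p
   (indices shifted to 0..p-1) *)
Definition s_mx : M := \matrix_(i, j) ((((i : nat).+1 %% p)%N == j)%:R).

(* r = permutation matrix of the transposition (1,2) (0-based: (0,1)) *)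
Definition swap01 (k : nat) : nat :=
  if k == 0%N then 1%N else if k == 1%N then 0%N else k.
Definition r_mx : M := \matrix_(i, j) ((swap01 i == j)%:R).

Definition admissible_A (A : mxset p) : Prop :=
  [/\ is_subgroup A, is_finite A,
      (forall g, A g -> diagonal g),
      (forall (sigma : 'S_p) g, A g ->
          A (invmx (perm_mx sigma) *m g *m perm_mx sigma)) &
      (exists g, A g /\ ~~ is_scalar_mx g)].

End Defs.

Definition zeta (m : nat) : CC :=
  (cos (2 * PI / INR m) +i* sin (2 * PI / INR m))%C.

Definition z_mx (p m : nat) : 'M[CC]_p := (zeta m)%:M.

Definition union3 p (x y : 'M[CC]_p) (A : mxset p) : mxset p :=
  fun g => g = x \/ g = y \/ A g.

Definition in_Rstar (p : nat) (G : mxset p) : Prop :=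
  exists (A : mxset p) (n : nat),
    [/\ admissible_A A,
        has_card (fun g => A g /\ Z2 g) (2 ^ n) &
        (same_set G (generated (union3 (s_mx p) (r_mx p) A)) \/
         same_set G (generated (union3 (s_mx p) (r_mx p *m z_mx p (2 ^ n.+1)) A)))].

(* Main.v *)
From Stdlib Require Import Reals.
From mathcomp Require Import all_boot all_order all_algebra all_fingroup all_solvable.
From mathcomp Require Import complex Rstruct.
From mathcomp Require Import ring.
Require Import Defs.

Set Implicit Arguments.
Unset Strict Implicit.
Unset Printing Implicit Defensive.
Import GRing.Theory.
Local Open Scope ring_scope.

                          

(** Elements of a monomial group are written d s, with d diagonal and s a permutation ([mon d s]);
    let a be the diagonal part, a group stable under reindexing. Let E be the group of all x for
    which a contains every diagonal matrix with x at one place, x^-1 at another and 1 elsewhere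
    ([spikes]). Ratios of entries of members of a lie in E, and a contains every d with entries in E
    and product 1 ([inv_spikes_prod1]). So when entries are changed by factors in E, only their
    product has to be watched ([mg_adjust]).

    Normal form. Members of a are scalar modulo E. Comparing lifts of disjoint transpositions, and
    squaring lifts of transpositions, shows that after conjugation by one diagonal matrix some lift
    of each (o j) is scalar modulo E ([mon_group_split]). Then one d, with d^2 in a, serves for all
    transpositions, and since p is odd d can be replaced by the scalar w that is the product of its
    entries ([near_split]). Hence G is conjugate to [Kset a w], the set of all products of a member
    of a with some w^sgn(s) s, where sgn is 0 or 1 and w^2 is in a. If a were scalar, G would
    stabilise a line; so irreducibility makes a nonscalar. An odd power of w has 2-power order and
    is congruent to w modulo a ([conjugate_to_Kset]).

    The list. A p-cycle and a transposition generate Sym(p) and the p-cycle is even, so the listed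
    groups are the [Kset a w] with w = 1 or w = z, a root of unity of order 2^(n+1). Conversely, a
    finite group of scalars consists of all roots of unity of its order, so a w of 2-power order
    with w^2 in a satisfies w^(2^n) = 1 or -1, that is, w is congruent to 1 or to z modulo a
    ([in_RstarP]). Irreducibility is [mon_irreducible].

    No further conjugacy. The diagonal part is abelian and normal, while in Sym(n), n >= 5, only 1
    commutes with all its conjugates. So a conjugating matrix maps diagonal part to diagonal part,
    which forces it to be monomial and the two diagonal parts to be equal; following one
    transposition then gives w'/w in a ([gl_conjugate_Kset]). *)

Lemma exists_notin (n : nat) (l : seq 'I_n) :
  (size l < n)%N -> exists i : 'I_n, i \notin l.
Proof.
move=> sz; apply/existsP; rewrite -negb_forall; apply/negP => /forallP H.
have: (#|'I_n| <= size l)%N.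
  by apply: leq_trans (card_size l); apply/subset_leq_card/subsetP => x _; apply: H.
by rewrite card_ord leqNgt sz.
Qed.

Lemma perm_pair (T : finType) (i j k l : T) :
  i != j -> k != l -> exists s : {perm T}, s i = k /\ s j = l.
Proof.
move=> ij kl; exists (tperm i k * tperm (tperm i k j) l)%g.
rewrite !permM tpermL tpermL; split=> //; rewrite tpermD //.
  by rewrite -[k in _ != k](tpermL i k) (inj_eq perm_inj) eq_sym.
by rewrite eq_sym.
Qed.

(** * Arithmetic of monomial matrices *)

Section Monomial.
Variables (F : fieldType) (n : nat).
Implicit Types (d e : 'I_n -> F) (s t : 'S_n).

(** The product of the diagonal matrix of [d] with the permutation matrix of [s]; [d] is a function,
    so that products and inverses are again explicit functions. *)
Definition mon d s : 'M[F]_n := \matrix_(i, j) (d i *+ (s i == j)).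

Lemma eq_mon d e s : d =1 e -> mon d s = mon e s.
Proof. by move=> de; apply/matrixP => i j; rewrite !mxE de. Qed.

Lemma mon_mul d e s t : mon d s *m mon e t = mon (fun i => d i * e (s i)) (s * t)%g.
Proof.
apply/matrixP => i j; rewrite !mxE (bigD1 (s i)) //= big1 ?addr0 => [|k ki].
  by rewrite !mxE eqxx permM mulr1n mulrnAr.
by rewrite !mxE eq_sym (negbTE ki) mulr0n mul0r.
Qed.

Lemma mon_scalar c : mon (fun=> c) 1 = c%:M.
Proof. by apply/matrixP => i j; rewrite !mxE perm1. Qed.

Lemma mon_diag (d : 'rV[F]_n) s : diag_mx d *m perm_mx s = mon (d 0) s.
Proof.
by rewrite mul_diag_mx; apply/matrixP => i j; rewrite !mxE mulr_natr.
Qed.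

Lemma mon_perm s : mon (fun=> 1) s = perm_mx s.
Proof. by apply/matrixP => i j; rewrite !mxE. Qed.

Lemma mon_inj d e s t :
  (forall i, d i != 0) -> mon d s = mon e t -> s = t /\ d =1 e.
Proof.
move=> nz E.
have st : s = t.
  apply/permP => i; move/matrixP: E => /(_ i (s i)); rewrite !mxE eqxx mulr1n.
  by case: eqP => // _ /eqP; rewrite mulr0n (negbTE (nz i)).
split=> // i; move/matrixP: E => /(_ i (s i)).
by rewrite !mxE -st eqxx !mulr1n.
Qed.

Lemma mon_mulV d s : (forall i, d i != 0) ->
  mon d s *m mon (fun i => (d (s^-1%g i))^-1) s^-1 = 1%:M.
Proof.
move=> nz; rewrite mon_mul mulgV -mon_scalar; apply: eq_mon => i.
by rewrite permK divff.
Qed.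

Lemma mon_unit d s : (forall i, d i != 0) -> mon d s \in unitmx.
Proof. by move=> nz; have [] := mulmx1_unit (mon_mulV s nz). Qed.

Lemma invmx_mon d s : (forall i, d i != 0) ->
  invmx (mon d s) = mon (fun i => (d (s^-1%g i))^-1) s^-1.
Proof.
move=> nz; rewrite -[LHS]mulmx1 -(mon_mulV s nz) mulmxA mulVmx ?mul1mx //.
exact: mon_unit.
Qed.

End Monomial.

(** * Permutation-invariant groups of diagonal matrices *)

Section Spikes.
Variables (F : fieldType) (n : nat).
Hypothesis n2 : (2 <= n)%N.
Implicit Types (d e : 'I_n -> F) (i j k : 'I_n) (x y : F).

Record inv_diag (a : ('I_n -> F) -> Prop) : Prop := InvDiag {
  inv_ext : forall d e, d =1 e -> a d -> a e;
  inv_one : a (fun=> 1);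
  inv_mul : forall d e, a d -> a e -> a (fun i => d i * e i);
  inv_inv : forall d, a d -> a (fun i => (d i)^-1);
  inv_perm : forall d (s : 'S_n), a d -> a (fun i => d (s i));
  inv_nz : forall d, a d -> forall i, d i != 0 }.

Definition spike i j x : 'I_n -> F :=
  fun k => if k == i then x else if k == j then x^-1 else 1.

Variable a : ('I_n -> F) -> Prop.
Hypothesis Ha : inv_diag a.

                                                                          
                                                                   
(** These x form the subgroup E of the multiplicative group modulo which diagonal entries are
    compared throughout. *)
Definition spikes x : Prop := forall i j, i != j -> a (spike i j x).

Lemma inv_div d e : a d -> a e -> a (fun i => d i / e i).
Proof. by move=> ad ae; apply: (inv_mul Ha ad); apply: (inv_inv Ha ae). Qed.

(** Reindex d so that i and j move to any chosen k and l, then divide by its image under the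
    transposition of k and l: everything cancels outside these two places. *)
Lemma spikes_ratio d i j : a d -> i != j -> spikes (d i / d j).
Proof.
move=> ad ij k l kl; have [s [sk sl]] := perm_pair kl ij.
have nz := inv_nz Ha ad.
have ad' := inv_perm Ha s ad.
apply: (inv_ext Ha _ (inv_div ad' (inv_perm Ha (tperm k l) ad'))) => m.
rewrite /spike; case: tpermP => [->|->|/eqP mk /eqP ml].
- by rewrite eqxx sk sl.
- by rewrite eq_sym (negbTE kl) eqxx sk sl invf_div.
- by rewrite (negbTE mk) (negbTE ml) divff.
Qed.

Lemma spikes1 : spikes 1.
Proof.
move=> i j ij; apply: (inv_ext Ha _ (inv_one Ha)) => k.
by rewrite /spike invr1; case: ifP => // _; case: ifP.
Qed.

Lemma spikesM x y : spikes x -> spikes y -> spikes (x * y).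
Proof.
move=> Ex Ey i j ij; apply: (inv_ext Ha _ (inv_mul Ha (Ex i j ij) (Ey i j ij))) => k.
by rewrite /spike; case: ifP => _ //; case: ifP => _; rewrite ?mulr1 ?invfM.
Qed.

Lemma spikesV x : spikes x -> spikes x^-1.
Proof.
move=> Ex i j ij; apply: (inv_ext Ha _ (inv_inv Ha (Ex i j ij))) => k.
by rewrite /spike; case: ifP => _ //; case: ifP => _; rewrite ?invr1.
Qed.

Lemma spikes_div x y : spikes x -> spikes y -> spikes (x / y).
Proof. by move=> Ex Ey; apply: spikesM => //; apply: spikesV. Qed.

Lemma spikes_prod (I : finType) (f : I -> F) :
  (forall u, spikes (f u)) -> spikes (\prod_u f u).
Proof. by move=> Ef; apply: big_ind => //; [apply: spikes1 | apply: spikesM]. Qed.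

Lemma inv_prod (I : finType) (P : pred I) (f : I -> 'I_n -> F) :
  (forall u, P u -> a (f u)) -> a (fun k => \prod_(u | P u) f u k).
Proof.
move=> Hf; elim: (index_enum I) => [|u r IH].
  by apply: (inv_ext Ha _ (inv_one Ha)) => k; rewrite big_nil.
case Pu: (P u).
  apply: (inv_ext Ha _ (inv_mul Ha (Hf u Pu) IH)) => k.
  by rewrite big_cons Pu.
by apply: (inv_ext Ha _ IH) => k; rewrite big_cons Pu.
Qed.

(** With a base point o, d is the product over i different from o of the spikes with d i at i and
    its inverse at o; the entry at o comes out right because the total product is 1. *)
Lemma inv_spikes_prod1 d : (forall i, spikes (d i)) -> \prod_i d i = 1 -> a d.
Proof.
move=> Ed d1; pose o := Ordinal (ltnW n2).
have := @inv_prod _ (fun i => i != o) (fun i => spike i o (d i))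
  (fun i io => Ed i i o io).
apply: (inv_ext Ha) => k; case: (eqVneq k o) => [->|ko].
  rewrite (eq_bigr (fun i => (d i)^-1)) => [|i io]; last first.
    by rewrite /spike eq_sym (negbTE io) eqxx.
  rewrite prodfV; move: d1; rewrite (bigD1 o) //= => d1.
  have nz : \prod_(i < n | i != o) d i != 0.
    by apply/eqP => z; move/eqP: d1; rewrite z mulr0 eq_sym oner_eq0.
  by apply: (mulIf nz); rewrite d1 mulVf.
rewrite (bigD1 k) //= /spike eqxx big1 ?mulr1 // => i /andP[_ ik].
by rewrite eq_sym (negbTE ik) (negbTE ko).
Qed.

Lemma inv_pow d m : a d -> a (fun i => d i ^+ m).
Proof.
move=> ad; elim: m => [|m IH].
  by apply: (inv_ext Ha _ (inv_one Ha)) => k.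
by apply: (inv_ext Ha _ (inv_mul Ha ad IH)) => k; rewrite exprS.
Qed.

End Spikes.

                                                              

Lemma prod_perm (F : fieldType) (T : finType) (t : {perm T}) (f : T -> F) :
  \prod_i f (t i) = \prod_i f i.
Proof. by rewrite [RHS](reindex_inj (@perm_inj _ t)). Qed.

(** * Monomial groups with full permutation part: lifts modulo E *)

Section MonGroup.
Variables (F : fieldType) (n : nat).
Hypothesis n5 : (5 <= n)%N.
Implicit Types (d e : 'I_n -> F) (s t : 'S_n) (i j k l : 'I_n) (x y : F).

(** [X d s] stands for membership of d s in the group; working with pairs avoids decomposing
    matrices at every step. *)
Record mon_group (X : ('I_n -> F) -> 'S_n -> Prop) : Prop := MonGroup {
  mg_ext : forall d e s, d =1 e -> X d s -> X e s;
  mg_mul : forall d s e t, X d s -> X e t -> X (fun i => d i * e (s i)) (s * t)%g;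
  mg_inv : forall d s, X d s -> X (fun i => (d (s^-1%g i))^-1) s^-1%g;
  mg_nz : forall d s, X d s -> forall i, d i != 0;
  mg_full : forall s, exists d, X d s }.

Variable X : ('I_n -> F) -> 'S_n -> Prop.
Hypothesis HX : mon_group X.

Let n2 : (2 <= n)%N. Proof. exact: (leq_trans _ n5). Qed.

Definition diag_part d := X d 1%g.
Local Notation a := diag_part.
Local Notation E := (spikes a).

Lemma mg_ratio d e s : X d s -> X e s -> a (fun i => d i / e i).
Proof.
move=> Xd Xe; have := mg_mul HX Xd (mg_inv HX Xe).
by rewrite mulgV; apply: mg_ext => // i; rewrite permK.
Qed.

Lemma mg_diag_mul d e s : a d -> X e s -> X (fun i => d i * e i) s.
Proof.
move=> ad Xe; have := mg_mul HX ad Xe.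
by rewrite mul1g; apply: mg_ext => // i; rewrite perm1.
Qed.

Lemma diag_part_inv_diag : inv_diag a.
Proof.
split.
- by move=> d e; apply: mg_ext.
- have [d Xd] := mg_full HX 1%g; apply: (mg_ext HX _ (mg_ratio Xd Xd)) => // i.
  by rewrite divff //; apply: (mg_nz HX Xd _).
- by move=> d e ad ae; apply: mg_diag_mul.
- move=> d ad; have := mg_inv HX ad; rewrite /a invg1.
  by apply: mg_ext => // i; rewrite perm1.
- move=> d s ad; have [e Xe] := mg_full HX s.
  have := mg_ratio (mg_mul HX Xe ad) _; rewrite mulg1 => /(_ _ Xe).
  apply: mg_ext => // i; rewrite mulrC mulKf //; exact: (mg_nz HX Xe _).
- by move=> d; apply: mg_nz.
Qed.
Local Notation Ha := diag_part_inv_diag.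

                                                                           
                               
(** Disjoint transpositions commute, so the two products of their lifts differ by a member of the
    diagonal part. Its entry at k is d k / d l and its entry at a fifth index m, fixed by both
    transpositions, is 1. *)
Lemma tperm_ratio d i j k l : X d (tperm i j) ->
  k != i -> k != j -> l != i -> l != j -> E (d k / d l).
Proof.
move=> Xd ki kj li lj; case: (eqVneq k l) => [->|kl].
  by rewrite divff; [apply: (spikes1 Ha)| apply: (mg_nz HX Xd _)].
have [e Xe] := mg_full HX (tperm k l).
have dnz := mg_nz HX Xd; have enz := mg_nz HX Xe.
have C : (tperm i j * tperm k l = tperm k l * tperm i j)%g.
  by apply/commgP/conjg_fixP; rewrite tpermJ !tpermD // eq_sym.
have := mg_mul HX Xe Xd; rewrite -C => /(mg_ratio (mg_mul HX Xd Xe)) ae.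
have [m] := @exists_notin n [:: i; j; k; l] n5.
rewrite !inE !negb_or => /and4P[mi mj mk ml].
have km : k != m by rewrite eq_sym.
have := spikes_ratio Ha ae km.
rewrite /= !(tpermD (z := m)) 1?eq_sym // tpermL tpermD 1?eq_sym //.
suff -> : d k * e k / (e k * d l) / (d m * e m / (e m * d m)) = d k / d l by [].
by field; rewrite !dnz !enz oner_neq0.
Qed.

(** The square of the lift is diagonal, with entry d i * d j at i and the square of d k at k. *)
Lemma tperm_square d i j k : X d (tperm i j) -> i != j ->
  k != i -> k != j -> E (d i * d j / (d k * d k)).
Proof.
move=> Xd ij ki kj; have := mg_mul HX Xd Xd; rewrite tperm2 => a2.
have ik : i != k by rewrite eq_sym.
by have := spikes_ratio Ha a2 ik; rewrite tpermL tpermD // eq_sym.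
Qed.

(** Being scalar modulo E. *)
Definition near_scalar d := exists2 c, c != 0 & forall i, E (d i / c).

Lemma near_mul d e s : near_scalar d -> near_scalar e ->
  near_scalar (fun i => d i * e (s i)).
Proof.
move=> [c c0 Ec] [c' c0' Ec']; exists (c * c'); first by rewrite mulf_neq0.
move=> i.
have -> : d i * e (s i) / (c * c') = (d i / c) * (e (s i) / c').
  by field; rewrite c0 c0'.
exact: (spikesM Ha (Ec _) (Ec' _)).
Qed.

Lemma near_diag d : a d -> near_scalar d.
Proof.
move=> ad; pose o := Ordinal (ltnW n2); exists (d o); first exact: (mg_nz HX ad _).
move=> i; case: (eqVneq i o) => [->|io]; last exact: (spikes_ratio Ha ad io).
by rewrite divff; [apply: (spikes1 Ha)| apply: (mg_nz HX ad _)].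
Qed.

(** The quotient e / d has entries in E and product 1, so [inv_spikes_prod1] puts it in the diagonal
    part. *)
Lemma mg_adjust d e s : X d s -> (forall i, E (e i / d i)) ->
  \prod_i e i = \prod_i d i -> X e s.
Proof.
move=> Xd Ed pr; have nz := mg_nz HX Xd.
have: a (fun i => e i / d i).
  apply: (inv_spikes_prod1 n2 Ha) => //.
  rewrite big_split /= pr prodfV divff //.
  by apply/prodf_neq0.
move/mg_diag_mul => /(_ _ _ Xd); apply: mg_ext => // i.
by rewrite divfK.
Qed.

Section Near.
Variable o : 'I_n.
Hypothesis Hnear : forall j, j != o -> exists2 d, X d (tperm o j) & near_scalar d.

(** The transpositions through o generate the symmetric group, and being scalar modulo E survives
    products. *)
Lemma exists_near s : exists2 d, X d s & near_scalar d.
Proof.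
have one : exists2 d, X d 1%g & near_scalar d.
  exists (fun=> 1); first exact: (inv_one Ha).
  by apply: near_diag; apply: (inv_one Ha).
have: s \in <<[set tperm o y | y in 'I_n]>>%g by rewrite gen_tperm inE.
case/gen_prodgP => m [c Hc ->]; 
apply: (big_ind (fun s => exists2 d, X d s & near_scalar d)) => //.
  move=> s1 s2 [d Xd Nd] [e Xe Ne]; exists (fun i => d i * e (s1 i)).
    exact: (mg_mul HX Xd Xe).
  exact: near_mul.
move=> i _; have /imsetP[y _ ->] := Hc i.
by case: (eqVneq y o) => [->|]; [rewrite tperm1 | apply: Hnear].
Qed.

Lemma all_near d s : X d s -> near_scalar d.
Proof.
move=> Xd; have [e Xe Ne] := exists_near s.
have := near_mul 1%g (near_diag (mg_ratio Xd Xe)) Ne.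
move=> [c c0 H]; exists c => // i; have := H i.
by rewrite perm1 divfK //; apply: (mg_nz HX Xe _).
Qed.

(** Conjugating by a lift of some s that carries one transposition to the other changes d by factors
    in E only, since all lifts are scalar modulo E, and keeps the product of the entries;
    [mg_adjust] then restores d. *)
Lemma tperm_same_diag d i j k l : X d (tperm i j) -> i != j -> k != l ->
  X d (tperm k l).
Proof.
move=> Xd ij kl; have [s [sk sl]] := perm_pair kl ij.
have [e Xe] := mg_full HX s.
have [c c0 Hc] := all_near Xd; have [c' c0' Hc'] := all_near Xe.
have st : (s * tperm i j * s^-1 = tperm k l)%g.
  have := tpermJ i j s^-1; rewrite -sk -sl !permK => <-.
  by rewrite conjgE invgK mulgA.
have Xf : X (fun u => e u * d (s u) / e (tperm k l u)) (tperm k l).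
  have := mg_mul HX (mg_mul HX Xe Xd) (mg_inv HX Xe).
  by rewrite st; apply: mg_ext => // u; rewrite -permM st.
apply: (mg_adjust Xf) => [u|].
  have -> : d u / (e u * d (s u) * (e (tperm k l u))^-1) =
    (d u / c) / ((e u / c') * (d (s u) / c) / (e (tperm k l u) / c')).
    by field; rewrite c0 c0' !(mg_nz HX Xe) !(mg_nz HX Xd).
  by apply: (spikes_div Ha) => //; apply: (spikes_div Ha) => //; apply: (spikesM Ha).
rewrite !big_split /=.
rewrite prodfV !prod_perm mulrAC divff ?mul1r //.
by apply/prodf_neq0 => u _; apply: (mg_nz HX Xe _).
Qed.

Lemma tperm_diag_sq d i j : X d (tperm i j) -> a (fun k => d k * d k).
Proof.
move=> Xd; have := mg_mul HX Xd Xd; rewrite tperm2 => a2.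
have [c c0 Hc] := all_near Xd.
apply: (mg_adjust a2) => [u|].
  have -> : d u * d u / (d u * d (tperm i j u)) =
     (d u / c) / (d (tperm i j u) / c).
    by field; rewrite c0 !(mg_nz HX Xd).
  exact: (spikes_div Ha _ _).
by rewrite !big_split /= prod_perm.
Qed.

(** Induction on a factorisation into transpositions, all lifted with the same d; pairs of factors d
    cancel because d^2 is in the diagonal part. *)
Lemma near_split_diag d i j s : X d (tperm i j) -> i != j ->
  X (fun k => d k ^+ (s : bool)) s.
Proof.
move=> Xd ij; have [ts -> ] := prod_tpermP s.
have [c c0 Hc] := all_near Xd.
have Xone : X (fun=> 1) 1%g by exact: (inv_one Ha).
elim: ts => [_|t ts IH /= /andP[t12 /IH {}IH]].
  by rewrite big_nil; apply: (mg_ext HX _ Xone) => // k; rewrite odd_perm1.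
rewrite big_cons odd_permM odd_tperm; rewrite /dpair /= in t12; rewrite t12.
set s' := (\prod_(t <- ts) _)%g in IH *.
have Xt := tperm_same_diag Xd ij t12.
have XX := mg_mul HX Xt IH.
have dnz := mg_nz HX Xd.
have XX' : X (fun k => d k * d k ^+ (s' : bool)) (tperm t.1 t.2 * s')%g.
  apply: (mg_adjust XX) => [u|].
    case: (s' : bool); rewrite ?expr0 ?expr1.
      have -> : d u * d u / (d u * d (tperm t.1 t.2 u)) =
         (d u / c) / (d (tperm t.1 t.2 u) / c) by field; rewrite c0 !dnz.
      exact: (spikes_div Ha _ _).
    by rewrite divff ?mulr1 //; apply: (spikes1 Ha).
  rewrite !big_split /=; congr (_ * _).
  by rewrite (prod_perm _ (fun u => d u ^+ (s' : bool))).
case: (s' : bool) XX' => /= XX'; last first.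
  by apply: (mg_ext HX _ XX') => // k; rewrite expr0 mulr1.
have := mg_diag_mul (inv_inv Ha (tperm_diag_sq Xd)) XX'.
by apply: mg_ext => // k; rewrite expr1 expr0 mulVf // mulf_neq0.
Qed.

                                                                           
                                                                    
(** For odd n, d^n is d times a power of d^2, so d^n lifts odd permutations as well. The constant w,
    the product of the entries of d, is congruent to d^n modulo E, and both have product w^n. *)
Lemma near_split : odd n -> exists2 w, w != 0 & forall s, X (fun=> w ^+ (s : bool)) s.
Proof.
move=> on; pose i := Ordinal (ltnW n2); pose j := Ordinal n2.
have ij : i != j by [].
have [d Xd] := mg_full HX (tperm i j).
have dnz := mg_nz HX Xd; have [c c0 Hc] := all_near Xd.
exists (\prod_k d k); first by apply/prodf_neq0.
move=> s; have := near_split_diag s Xd ij.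
case: (s : bool) => Xs; last by apply: (mg_ext HX _ Xs) => // k; rewrite expr0.
have Xn : X (fun k => d k ^+ n) s.
  have := mg_diag_mul (inv_pow Ha n./2 (tperm_diag_sq Xd)) Xs.
  apply: mg_ext => // k.
  by rewrite -{2}(odd_double_half n) on exprD -expr2 -exprM mul2n mulrC.
apply: (mg_adjust Xn) => [u|]; last first.
  by rewrite expr1 prodr_const card_ord prodrXl.
have -> : (\prod_k d k) ^+ true / d u ^+ n = \prod_k (d k / d u).
  by rewrite expr1 big_split /= prodr_const card_ord exprVn.
apply: (spikes_prod Ha) => v.
have -> : d v / d u = (d v / c) / (d u / c) by field; rewrite c0 dnz.
exact: (spikes_div Ha _ _).
Qed.
End Near.

End MonGroup.

(** * Diagonal conjugation into split form *)

Section Rescale.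
Variables (F : fieldType) (n : nat).
Hypothesis n5 : (5 <= n)%N.
Variable X : ('I_n -> F) -> 'S_n -> Prop.
Hypothesis HX : mon_group X.

(** The conjugate v^-1 X v of the group by the diagonal matrix v. *)
Definition rescale (v d : 'I_n -> F) (s : 'S_n) := X (fun i => v i * d i / v (s i)) s.

Lemma rescale_mon_group v : (forall i, v i != 0) -> mon_group (rescale v).
Proof.
move=> vnz; split; rewrite /rescale.
- by move=> d e s de; apply: mg_ext => // i; rewrite de.
- move=> d s e t Xd Xe; apply: (mg_ext HX _ (mg_mul HX Xd Xe)) => // i.
  by rewrite permM; field; rewrite !vnz.
- move=> d s Xd; have dnz := mg_nz HX Xd.
  have nz k : d k != 0.
    by apply: contraNneq (dnz k) => ->; rewrite mulr0 mul0r.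
  apply: (mg_ext HX _ (mg_inv HX Xd)) => // i; rewrite permKV.
  by field; rewrite !vnz nz.
- move=> d s /(mg_nz HX) dnz k.
  by apply: contraNneq (dnz k) => ->; rewrite mulr0 mul0r.
- move=> s; have [d Xd] := mg_full HX s.
  exists (fun i => d i * v (s i) / v i); apply: (mg_ext HX _ Xd) => // i.
  by field; rewrite !vnz.
Qed.

Lemma rescale_diag v d : (forall i, v i != 0) ->
  diag_part (rescale v) d <-> diag_part X d.
Proof.
move=> vnz; rewrite /diag_part /rescale.
by split; apply: mg_ext => // i; rewrite perm1 mulrAC divff ?mul1r.
Qed.

Lemma mon_group_split : odd n -> exists v w,
  [/\ forall i : 'I_n, v i != 0, w != 0 &
      forall s : 'S_n, rescale v (fun=> w ^+ (s : bool)) s].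
Proof.
have n2 : (2 <= n)%N by exact: (leq_trans _ n5).
pose o := Ordinal (ltnW n2).
(* The value d k / d o makes the rescaled lift of (o j) have entry d k at o. Its entry at j becomes
   d o * d j / d k, congruent to d k by [tperm_square], and the other entries are unchanged and
   congruent to d k by [tperm_ratio]. *)
have Hex (j : 'I_n) : exists x : F, [/\ x != 0, (j = o -> x = 1) &
    (j != o -> exists d k, [/\ X d (tperm o j), k != o, k != j & x = d k / d o])].
  case: (eqVneq j o) => [->|jo].
    by exists 1; split=> //; rewrite oner_neq0.
  have [d Xd] := mg_full HX (tperm o j).
  have [k] := @exists_notin n [:: o; j] (leq_trans (isT : 2 < 5)%N n5).
  rewrite !inE negb_or => /andP[ko kj].
  exists (d k / d o); split=> // [|/eqP|_]; last by exists d, k.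
    by rewrite mulf_neq0 // ?invr_eq0; apply: (mg_nz HX Xd _).
  by rewrite (negbTE jo).
have {Hex} [v Hv] := fin_all_exists Hex.
have vnz i : v i != 0 by have [] := Hv i.
have vo : v o = 1 by have [_ ->] := Hv o.
have HX' := rescale_mon_group vnz.
move=> on; suff Hnear j : j != o ->
    exists2 d, rescale v d (tperm o j) & near_scalar (rescale v) d.
  by have [w w0 Hw] := near_split n5 HX' Hnear on; exists v, w.
move=> jo; have [_ _ /(_ jo) [d [k [Xd ko kj vj]]]] := Hv j.
have dnz := mg_nz HX Xd.
exists (fun i => d i * v (tperm o j i) / v i).
  by apply: (mg_ext HX _ Xd) => // i; field; rewrite !vnz.
have ext x : spikes (diag_part X) x -> spikes (diag_part (rescale v)) x.
  by move=> Ex i i' ii'; apply/rescale_diag => //; apply: Ex.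
exists (d k); first exact: dnz.
move=> i; apply: ext; case: tpermP => [->|->|/eqP io /eqP ij].
- rewrite vo vj; have -> : d o * (d k / d o) / 1 / d k = 1.
    by field; rewrite !dnz ?oner_neq0.
  exact: (spikes1 (diag_part_inv_diag HX)).
- rewrite vo vj; have -> : d j * 1 / (d k / d o) / d k = d o * d j / (d k * d k).
    by field; rewrite !dnz ?oner_neq0.
  by apply: (tperm_square HX Xd) => //; rewrite eq_sym.
- rewrite mulfK //; exact: (tperm_ratio n5 HX Xd).
Qed.
End Rescale.

                                               

(** * The groups [Kset a w] in normal form *)

Section Sets.
Variable p : nat.
Implicit Types (d e : 'I_p -> CC) (s t : 'S_p) (A G : mxset p) (w : CC).

Definition mxof (X : ('I_p -> CC) -> 'S_p -> Prop) : mxset p :=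
  fun g => exists d s, X d s /\ g = mon d s.

Definition dset (a : ('I_p -> CC) -> Prop) : mxset p :=
  fun g => exists2 d, a d & g = mon d 1%g.

                                                                     
(** Membership of d s in the product of a with the lift w^sgn(s) s. These lifts multiply correctly
    up to w^2, which is why w^2 is asked to lie in a. *)
Definition signed (a : ('I_p -> CC) -> Prop) w d s : Prop :=
  a (fun i => d i / w ^+ (s : bool)).

Definition Kset a w : mxset p := mxof (signed a w).

Lemma mxofE X d s : mon_group X -> mxof X (mon d s) <-> X d s.
Proof.
move=> HX; split=> [[e [t [Xe E]]]|Xd]; last by exists d, s.
have [<- ed] := mon_inj (mg_nz HX Xe) (esym E).
exact: (mg_ext HX ed Xe).
Qed.

Lemma mxof_subgroup X : mon_group X -> is_subgroup (mxof X).
Proof.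
move=> HX; split.
- have [d Xd] := mg_full HX 1%g; exists (fun=> 1), 1%g; rewrite mon_scalar; split=> //.
  exact: (inv_one (diag_part_inv_diag HX)).
- by move=> _ [d [s [Xd ->]]]; apply: mon_unit; apply: (mg_nz HX Xd).
- move=> _ _ [d [s [Xd ->]]] [e [t [Xe ->]]]; rewrite mon_mul.
  by do 2!eexists; split; last by []; apply: (mg_mul HX Xd Xe).
- move=> _ [d [s [Xd ->]]]; rewrite invmx_mon; last exact: (mg_nz HX Xd).
  by do 2!eexists; split; last by []; apply: (mg_inv HX Xd).
Qed.

Lemma dsetE a d : inv_diag a -> dset a (mon d 1) <-> a d.
Proof.
move=> Ha; split=> [[e ae E]|ad]; last by exists d.
have [_ ed] := mon_inj (inv_nz Ha ae) (esym E).
exact: (inv_ext Ha ed ae).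
Qed.

Lemma signed_mon_group a w : inv_diag a -> w != 0 -> a (fun=> w ^+ 2) ->
  mon_group (signed a w).
Proof.
move=> Ha w0 aw; have wn0 (b : bool) : w ^+ b != 0 by rewrite expf_neq0.
rewrite /signed; split.
- by move=> d e s de; apply: (inv_ext Ha) => i; rewrite de.
- move=> d s e t ad ae; have := inv_mul Ha ad (inv_perm Ha s ae).
  (* Signs fail to add up only for two odd factors; the surplus w^2 is then absorbed by [aw]. *)
  case E: ((s : bool) && t) => H.
    case/andP: E => ss tt; move: H (inv_mul Ha H aw); rewrite odd_permM ss tt /= => _.
    by apply: (inv_ext Ha) => i; rewrite expr0 expr1; field.
  move: H; apply: (inv_ext Ha) => i; rewrite odd_permM.
  move: E; case: (s : bool); case: (t : bool) => //= _; rewrite ?expr0 ?expr1; field;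
  by rewrite ?w0 ?oner_neq0.
- move=> d s ad; have := inv_inv Ha (inv_perm Ha s^-1%g ad).
  rewrite odd_permV; case: (s : bool) => H; last first.
    by apply: (inv_ext Ha _ H) => i; rewrite expr0 !divr1.
  have := inv_div Ha H aw; apply: (inv_ext Ha) => i.
  by rewrite expr1 invf_div; move: (d _)^-1 => y; field.
- move=> d s /(inv_nz Ha) nz i; apply: contraNneq (nz i) => ->.
  by rewrite mul0r.
- move=> s; exists (fun=> w ^+ s); apply: (inv_ext Ha _ (inv_one Ha)) => i.
  by rewrite divff.
Qed.

Lemma signed_diag a w d : inv_diag a -> diag_part (signed a w) d <-> a d.
Proof.
move=> Ha; rewrite /diag_part /signed.
by split; apply: (inv_ext Ha) => i; rewrite odd_perm1 expr0 divr1.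
Qed.

Lemma Kset_finite a w : inv_diag a -> w != 0 ->
  is_finite (dset a) -> is_finite (Kset a w).
Proof.
move=> Ha w0 [l Hl].
have wn0 (b : bool) : w ^+ b != 0 by rewrite expf_neq0.
exists [seq mon (fun i => (g : 'M[CC]_p) i i * w ^+ (s : bool)) s |
  g <- l, s <- enum 'S_p].
move=> g; split=> [[d [s [ad ->]]]|/allpairsP[[h s] /= [/Hl [d ad ->] _ ->]]].
  apply/allpairsP; exists (mon (fun i => d i / w ^+ (s : bool)) 1, s) => /=.
  split; rewrite ?mem_enum //; first by apply/Hl; exists (fun i => d i / w ^+ (s : bool)).
  by apply: eq_mon => i; rewrite !mxE perm1 eqxx mulr1n divfK.
exists (fun i => d i * w ^+ (s : bool)), s; split; last first.
  by apply: eq_mon => i; rewrite !mxE perm1 eqxx mulr1n.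
by apply: (inv_ext Ha _ ad) => i; rewrite mulfK.
Qed.

(** Only the class of w modulo the scalars in a matters; this is what allows w to be normalised. *)
Lemma Kset_ratio a w w' : inv_diag a -> w != 0 -> w' != 0 -> a (fun=> w' / w) ->
  same_set (Kset a w) (Kset a w').
Proof.
move=> Ha w0 w'0 aw g.
split=> -[d [s [ad ->]]]; exists d, s; split=> //; move: ad; rewrite /signed.
  case: (s : bool) => // ad; have := inv_div Ha ad aw.
  by apply: (inv_ext Ha) => i; rewrite !expr1; field; rewrite w0 w'0.
case: (s : bool) => // ad; have := inv_mul Ha ad aw.
by apply: (inv_ext Ha) => i; rewrite !expr1; field; rewrite w0 w'0.
Qed.

End Sets.

(** * Irreducibility from a nonscalar diagonal element *)

Section Irreducible.
Variable p : nat.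
Hypothesis p3 : (3 <= p)%N.

Lemma row_full_delta (U : 'M[CC]_p) :
  (forall k : 'I_p, (('e_k : 'rV[CC]_p) <= U)%MS) -> row_full U.
Proof.
move=> H; rewrite -sub1mx; apply/row_subP => k.
by rewrite row1; apply: H.
Qed.

(** A nonscalar diagonal element gives a spike with x different from 1. For a vector of U with
    nonzero coordinate k, apply spike minus identity at (k, j) and then at (k, l): the first leaves
    only coordinates k and j, the second kills j. So U contains the k-th basis vector, and lifts of
    transpositions carry it to all the others. *)
Lemma mon_irreducible X : mon_group X ->
  (exists d i j, diag_part X d /\ d i != d j) ->
  irreducible_set (mxof X : mxset p).
Proof.
move=> HX [d0 [i0 [j0 [ad dij]]]] U HU.
have Ha := diag_part_inv_diag HX.
have d0nz := inv_nz Ha ad.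
have ij0 : i0 != j0 by apply: contraNneq dij => ->.
have := spikes_ratio Ha ad ij0; set x := _ / _ => Ex.
have x1 : x - 1 != 0.
  rewrite subr_eq0; apply: contraNneq dij => x1.
  by rewrite -[d0 i0](divfK (d0nz j0)) -/x x1 mul1r.
case: (eqVneq U 0) => [|U0]; [by left | right].
have subM (v : 'rV_p) d s : X d s -> (v <= U)%MS -> (v *m mon d s <= U)%MS.
  by move=> Xd vU; apply: submx_trans (submxMr _ vU) (HU _ _); exists d, s.
have /matrix0Pn[i [k Uik]] := U0.
have [j] := @exists_notin p [:: k] (ltnW p3); rewrite inE => jk.
have [l] := @exists_notin p [:: k; j] p3; rewrite !inE negb_or => /andP[lk lj].
have vU : (row i U <= U)%MS by apply: row_sub.
have kj : k != j by rewrite eq_sym.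
have kl : k != l by rewrite eq_sym.
set v := row i U in vU.
pose v1 := v *m mon (spike k j x) 1 - v.
have v1U : (v1 <= U)%MS by rewrite addmx_sub // ?eqmx_opp //; apply: subM vU; apply: Ex.
pose v2 := v1 *m mon (spike k l x) 1 - v1.
have v2U : (v2 <= U)%MS by rewrite addmx_sub // ?eqmx_opp //; apply: subM v1U; apply: Ex.
have mE (u : 'rV_p) (d : 'I_p -> CC) m : (u *m mon d 1) 0 m = u 0 m * d m.
  rewrite mxE (bigD1 m) //= big1 ?addr0; first by rewrite mxE perm1 eqxx mulr1n.
  by move=> q qm; rewrite mxE perm1 (negbTE qm) mulr0n mulr0.
have subE (u : 'rV_p) (d : 'I_p -> CC) m : (u *m mon d 1 - u) 0 m = u 0 m * (d m - 1).
  by rewrite mxE mE mxE mulrBr mulr1.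
have v2E : v2 = (U i k * (x - 1) ^+ 2) *: 'e_k.
  apply/rowP => m; rewrite /v2 subE /v1 subE !mxE eqxx /= /spike.
  case: (eqVneq m k) => [->|mk]; first by rewrite mulr1 expr2 mulrA.
  rewrite mulr0; case: (eqVneq m j) => [->|mj].
    by rewrite eq_sym (negbTE lj) subrr mulr0.
  by rewrite subrr mulr0 mul0r.
apply: row_full_delta => m.
have kU : (('e_k : 'rV[CC]_p) <= U)%MS.
  have c0 : U i k * (x - 1) ^+ 2 != 0 by rewrite mulf_neq0 // expf_neq0.
  have -> : 'e_k = (U i k * (x - 1) ^+ 2)^-1 *: v2 by rewrite v2E scalerA mulVf ?scale1r.
  exact: scalemx_sub.
have [e Xe] := mg_full HX (tperm k m).
have := subM _ _ _ Xe kU.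
have -> : 'e_k *m mon e (tperm k m) = e k *: 'e_m :> 'rV[CC]_p.
  apply/rowP => q; rewrite !mxE eqxx /= (bigD1 k) //= big1 ?addr0.
    by rewrite !mxE !eqxx tpermL mul1r eq_sym mulr_natr.
  by move=> r rk; rewrite mxE (negbTE rk) andbF mul0r.
by rewrite (eqmx_scale _ (mg_nz HX Xe k)).
Qed.

End Irreducible.

                                      

(** * The listed generators produce [Kset a c] *)

Section Generators.
Variable p : nat.
Implicit Types (B K : mxset p).

Lemma generated_sub B K : is_subgroup K -> (forall g : 'M_p, B g -> K g) ->
  forall g : 'M_p, generated B g -> K g.
Proof.
move=> [K1 _ KM KV] SK _ [l [Hl ->]]; elim: l Hl => [|x l IH] Hl //=.
apply: KM; last by apply: IH => y yl; apply: Hl; rewrite inE yl orbT.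
have [/SK //|/SK /KV] := Hl x (mem_head _ _).
by rewrite invmxK.
Qed.

Lemma generated_in B g : B g -> generated B g.
Proof.
move=> Sg; exists [:: g]; split=> [x|]; last by rewrite /= mulmx1.
by rewrite inE => /eqP ->; left.
Qed.

Lemma generatedM B g h : generated B g -> generated B h -> generated B (g *m h).
Proof.
move=> [l [Hl ->]] [m [Hm ->]]; exists (l ++ m); split=> [x|].
  by rewrite mem_cat => /orP[/Hl|/Hm].
by elim: l {Hl} => [|x l IH] /=; rewrite ?mul1mx // -mulmxA IH.
Qed.

Definition cycle_perm : 'S_p := perm (@ordS_inj p).

Lemma s_mxE : s_mx p = mon (fun=> 1) cycle_perm.
Proof. by apply/matrixP => i j; rewrite !mxE permE. Qed.

Lemma cycle_permX k (i : 'I_p) : ((cycle_perm ^+ k)%g i = (i + k) %% p :> nat)%N.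
Proof.
elim: k i => [|k IH] i; first by rewrite expg0 perm1 addn0 modn_small.
by rewrite expgS permM IH permE /= modnDml addSnnS.
Qed.

Hypothesis p_pr : prime p.

Lemma order_cycle_perm : #[cycle_perm]%g = p.
Proof.
have n1 : #[cycle_perm]%g != 1%N.
  rewrite order_eq1; apply/eqP => /permP /(_ (Ordinal (prime_gt0 p_pr))) /(congr1 val).
  by rewrite perm1 permE /= modn_small // prime_gt1.
apply/(prime_nt_dvdP p_pr n1); rewrite order_dvdn; apply/eqP/permP => i; apply: ord_inj.
by rewrite cycle_permX perm1 modnDr modn_small.
Qed.

(** The sign of the cycle has odd p-th power equal to that of the identity. *)
Lemma odd_cycle_perm : odd p -> odd_perm cycle_perm = false.
Proof.
move=> op; have H k : odd_perm (cycle_perm ^+ k)%g = odd k && cycle_perm.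
  elim: k => [|k IH]; first by rewrite expg0 odd_perm1.
  by rewrite expgS odd_permM IH /=; case: (odd k); case: (odd_perm _).
have := H p; have -> : (cycle_perm ^+ p = 1)%g.
  by apply/eqP; rewrite -order_dvdn order_cycle_perm.
by rewrite odd_perm1 op.
Qed.

Let o : 'I_p := Ordinal (prime_gt0 p_pr).
Let i1 : 'I_p := Ordinal (prime_gt1 p_pr).

Lemma r_mxE : r_mx p = mon (fun=> 1) (tperm o i1).
Proof.
apply/matrixP => i j; rewrite !mxE; congr ((_ : bool)%:R).
rewrite -val_eqE /swap01 /=; case: tpermP => [->|->|/eqP io /eqP i1'] //=.
have /negbTE -> : (i != 0 :> nat)%N by rewrite (inj_eq val_inj i o) in io *.
by have /negbTE -> : (i != 1 :> nat)%N by [].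
Qed.

(** For prime p the cycle and the transposition generate Sym(p). The cycle is even, so its lift
    carries no factor c, and a word in the generators lifts s up to powers of c^2, which lie in
    a. *)
Lemma generated_Kset (A : mxset p) a c : odd p -> inv_diag a ->
  same_set A (dset a) -> c != 0 -> a (fun=> c ^+ 2) ->
  same_set (generated (union3 (s_mx p) (r_mx p *m c%:M) A)) (Kset a c).
Proof.
move=> op Ha HA c0 ac.
have HX := signed_mon_group Ha c0 ac.
have rE : r_mx p *m c%:M = mon (fun=> c) (tperm o i1).
  by rewrite r_mxE -mon_scalar mon_mul mulg1; apply: eq_mon => i; rewrite mul1r.
have HC : same_set (generated (union3 (mon (fun=> 1) cycle_perm)
    (mon (fun=> c) (tperm o i1)) A)) (Kset a c); last by rewrite rE s_mxE.
set B := union3 _ _ _.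
have genA d : a d -> generated B (mon d 1).
  by move=> ad; apply: generated_in; right; right; apply/HA; exists d.
move=> g; split.
  apply: generated_sub; first exact: mxof_subgroup HX.
  move=> h [->|[->|/HA [d ad ->]]].
  - exists (fun=> 1), cycle_perm; split=> //; rewrite /signed odd_cycle_perm //.
    by apply: (inv_ext Ha _ (inv_one Ha)) => i; rewrite expr0 divr1.
  - exists (fun=> c), (tperm o i1); split=> //; rewrite /signed odd_tperm.
    by apply: (inv_ext Ha _ (inv_one Ha)) => i; rewrite /= expr1 divff.
  - by exists d, 1%g; split=> //; apply/signed_diag.
have gens (s : 'S_p) : generated B (mon (fun=> c ^+ (s : bool)) s).
  have: s \in <<[set tperm o i1; cycle_perm]>>%g.
    rewrite (@gen_tperm_circular_shift _ o i1 cycle_perm) ?card_ord ?inE //.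
      exact: order_cycle_perm.
  case/gen_prodgP => m [f Hf ->].
  apply: (big_ind (fun s : 'S_p => generated B (mon (fun=> c ^+ (s : bool)) s))).
  - by rewrite odd_perm1; apply: genA; apply: inv_one Ha.
  - move=> s1 s2 H1 H2; have H := generatedM H1 H2; move: H; rewrite mon_mul odd_permM.
    case: (s1 : bool); case: (s2 : bool) => //= H.
    + have := generatedM (genA _ (inv_inv Ha ac)) H; rewrite mon_mul mul1g.
      by congr (generated B _); apply: eq_mon => i; rewrite expr0 expr1; field.
    + by congr (generated B _): H; apply: eq_mon => i; rewrite mulr1.
    + by congr (generated B _): H; apply: eq_mon => i; rewrite mul1r.
    + by congr (generated B _): H; apply: eq_mon => i; rewrite mul1r.
  - move=> k _; have := Hf k; rewrite !inE => /orP[/eqP->|/eqP->].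
      by rewrite odd_tperm /= expr1; apply: generated_in; right; left.
    by rewrite odd_cycle_perm // expr0; apply: generated_in; left.
move=> [d [s [ad ->]]].
have := generatedM (genA _ ad) (gens s); rewrite mon_mul mul1g.
congr (generated B _); apply: eq_mon => i.
by rewrite divfK // expf_neq0.
Qed.

End Generators.

(** * Roots of unity and finite groups of scalars *)

Lemma de_moivre (x : R) k :
  (cos x +i* sin x)%C ^+ k = (cos (INR k * x) +i* sin (INR k * x))%C.
Proof.
elim: k => [|k IH].
  by rewrite expr0 Rmult_0_l cos_0 sin_0.
rewrite exprS IH S_INR Rmult_plus_distr_r Rmult_1_l Rplus_comm cos_plus sin_plus.
by congr (_ +i* _)%C; apply: addrC.
Qed.

Lemma zeta_half n : zeta (2 ^ n.+1) ^+ (2 ^ n) = -1.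
Proof.
rewrite /zeta de_moivre.
have -> : Rmult (INR (2 ^ n)) (Rdiv (Rmult 2 PI) (INR (2 ^ n.+1))) = PI.
  rewrite expnS mult_INR -(INR_IZR_INZ 2).
  have : INR (2 ^ n) <> 0%R by apply: not_0_INR => /eqP; rewrite expn_eq0.
  have : INR 2 <> 0%R by apply: not_0_INR.
  move: (INR 2) (INR (2 ^ n)) PI => x y z /eqP x0 /eqP y0.
  rewrite RdivE.
  rewrite -[LHS]/(y * (x * z / (x * y))).
  by field; rewrite x0 y0.
by rewrite cos_PI sin_PI; congr (_ +i* _)%C; rewrite oppr0.
Qed.

                                 

(** Multiplication by a member x permutes the list, so x to the size fixes the nonzero product of
    all members. Conversely, a polynomial X^m - 1 has at most m roots, already supplied by the
    list. *)
Lemma mem_finite_mulgroup (F : fieldType) (l : seq F) : uniq l -> (0 < size l)%N ->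
  (forall x, x \in l -> x != 0) ->
  (forall x y, x \in l -> y \in l -> x * y \in l) ->
  forall x, (x \in l) = (x ^+ size l == 1).
Proof.
move=> ul sl nz lM.
have root_l x : x \in l -> x ^+ size l == 1.
  move=> xl; have pl : perm_eq [seq x * y | y <- l] l.
    have um : uniq [seq x * y | y <- l] by rewrite map_inj_uniq //; apply/mulfI/nz.
    apply: uniq_perm => //; apply: (uniq_min_size um _ _).2; last by rewrite size_map.
    by move=> _ /mapP[y yl ->]; apply: lM.
  have := perm_big _ pl (op := *%R) (x := 1) (P := predT) (F := id).
  rewrite big_map big_split /= big_const_seq count_predT -Monoid.iteropE /= => E.
  have P0 : \prod_(y <- l) y != 0.
    by rewrite prodf_seq_neq0; apply/allP => y /nz.
  by apply/eqP/(mulIf P0); rewrite mul1r -[RHS]E.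
move=> x; apply/idP/idP => [/root_l //|xr]; apply: contraT => xl.
have := @max_unity_roots _ (size l) (x :: l) sl.
rewrite /= xl ul unity_rootE xr ltnn; apply=> //.
by apply/allP => y /root_l; rewrite unity_rootE.
Qed.

(** The order of [zeta (2 ^ m.+1)] is a power of 2 that does not divide 2^m, by [zeta_half]; a
    suitable power of it therefore has order exactly 2^m. *)
Lemma exists_prim_root_pow2 m : exists z : CC, (2 ^ m)%N.-primitive_root z.
Proof.
have zm : zeta (2 ^ m.+1) ^+ (2 ^ m.+1) = 1.
  by rewrite [X in _ ^+ X]expnSr exprM zeta_half sqrrN expr1n.
have [k zk] := prim_order_exists (expn_gt0 2 m.+1) zm.
case/(dvdn_pfactor _ _ (isT : prime 2)) => j jm kE.
exists (zeta (2 ^ m.+1) ^+ (k %/ 2 ^ m)); apply: (dvdn_prim_root zk).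
rewrite kE; apply: dvdn_exp2l; rewrite leqNgt; apply/negP => jltm.
have : zeta (2 ^ m.+1) ^+ (2 ^ m) = 1.
  by apply/eqP; rewrite -(prim_order_dvd zk) kE dvdn_exp2l // ltnW.
rewrite zeta_half => /eqP; rewrite -subr_eq0 -opprD oppr_eq0.
by rewrite -[1 + 1]/(2%:R) Num.Theory.pnatr_eq0.
Qed.

Section Scalars.
Variable p : nat.
Hypothesis p0 : (0 < p)%N.
Variable a : ('I_p -> CC) -> Prop.
Hypothesis Ha : inv_diag a.
Implicit Types c w : CC.

Let o : 'I_p := Ordinal p0.

Lemma scalar_inj (c c' : CC) : c%:M = c'%:M :> 'M_p -> c = c'.
Proof. by move/matrixP/(_ o o); rewrite !mxE eqxx !mulr1n. Qed.

(** Turns the cardinality 2^n into an equation: the scalars of 2-power order in a form a finite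
    group, to which [mem_finite_mulgroup] applies. *)
Lemma card_Z2_root n : has_card (fun g => dset a g /\ Z2 g) (2 ^ n) ->
  forall c, c ^+ (2 ^ n) = 1 <-> a (fun=> c) /\ exists k, c ^+ (2 ^ k) = 1.
Proof.
move=> [l [ul sl Hl]].
have memP c : (c \in [seq g o o | g : 'M_p <- l]) <->
    a (fun=> c) /\ exists k, c ^+ (2 ^ k) = 1.
  split=> [/mapP[g /Hl [[d ad gE] [c' [k [gE' ck]]]] ->]|[ac [k ck]]].
    rewrite gE' mxE eqxx mulr1n; split; last by exists k.
    by apply/(dsetE _ Ha); rewrite mon_scalar -gE' gE; apply/dsetE.
  apply/mapP; exists (c%:M); last by rewrite mxE eqxx.
  by apply/Hl; split; [rewrite -mon_scalar; apply/dsetE | exists c, k].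
have um : uniq [seq g o o | g : 'M_p <- l].
  rewrite map_inj_in_uniq // => g h /Hl [_ [c [k [-> _]]]] /Hl [_ [c' [k' [-> _]]]].
  by rewrite !mxE eqxx !mulr1n => ->.
have sm : size [seq g o o | g : 'M_p <- l] = (2 ^ n)%N by rewrite size_map.
move=> c; rewrite -memP mem_finite_mulgroup ?sm ?expn_gt0 //.
- by split=> /eqP.
- by move=> x /memP[/(inv_nz Ha) /(_ o)].
move=> x y /memP[ax [k xk]] /memP[ay [k' yk']]; apply/memP; split.
  exact: (inv_mul Ha ax ay).
exists (k + k')%N; rewrite exprMn expnD exprM xk expr1n mul1r.
by rewrite mulnC exprM yk' expr1n.
Qed.

Lemma scalar_list : is_finite (dset a) -> exists C : seq CC,
  [/\ (0 < size C)%N, forall c, (c \in C) <-> a (fun=> c) &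
      forall c, (c \in C) = (c ^+ size C == 1)].
Proof.
move=> [l Hl].
pose C := undup [seq g o o | g : 'M_p <- l & is_scalar_mx g].
have memC c : (c \in C) <-> a (fun=> c).
  rewrite mem_undup; split=> [/mapP[g]|ac].
    rewrite mem_filter => /andP[/is_scalar_mxP[c' gE] /Hl ag] ->.
    by rewrite gE mxE eqxx mulr1n; apply/(dsetE _ Ha); rewrite mon_scalar -gE.
  apply/mapP; exists (c%:M); last by rewrite mxE eqxx.
  rewrite mem_filter scalar_mx_is_scalar; apply/Hl.
  by rewrite -mon_scalar; apply/dsetE.
have C1 : 1 \in C by apply/memC; apply: (inv_one Ha).
have sC : (0 < size C)%N by rewrite lt0n size_eq0; apply: contraTneq C1 => ->.
exists C; split=> //; apply: mem_finite_mulgroup => //; first exact: undup_uniq.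
  by move=> x /memC/(inv_nz Ha)/(_ o).
by move=> x y /memC ax /memC ay; apply/memC; apply: (inv_mul Ha ax ay).
Qed.

Lemma exists_card_Z2 : is_finite (dset a) ->
  exists n, has_card (fun g => dset a g /\ Z2 g) (2 ^ n).
Proof.
move=> /scalar_list [C [sC memC rootC]].
(* The scalars of a are the roots of unity of order dividing the size of C; those of 2-power order
   are cut out by its 2-part. *)
set m := logn 2 (size C).
have mC : (2 ^ m %| size C)%N by apply: pfactor_dvdnn.
have [z zm] := exists_prim_root_pow2 m.
have rootm c : (c ^+ (2 ^ m) = 1) <-> a (fun=> c) /\ exists k, c ^+ (2 ^ k) = 1.
  split=> [cm|[/memC cC [k ck]]].
    split; last by exists m.
    apply/memC; rewrite rootC; case/dvdnP: mC => q ->.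
    by rewrite mulnC exprM cm expr1n.
  move: cC; rewrite rootC => /eqP cC.
  have [q cq qC] := prim_order_exists sC cC.
  have : (q %| 2 ^ k)%N by rewrite (prim_order_dvd cq) ck.
  case/(dvdn_pfactor _ _ (isT : prime 2)) => j jm qE.
  by apply/eqP; rewrite -(prim_order_dvd cq) qE dvdn_exp2l // /m -pfactor_dvdn // -qE.
exists m, [seq (z ^+ i)%:M | i <- iota 0 (2 ^ m)]; split.
- rewrite map_inj_in_uniq ?iota_uniq // => i j; rewrite !mem_iota add0n /= => im jm.
  by move/scalar_inj/eqP; rewrite (eq_prim_root_expr zm) !modn_small // => /eqP.
- by rewrite size_map size_iota.
move=> g; split=> [[[d ad gE] [c [k [gE' ck]]]]|/mapP[i _ ->]].
  have cm : c ^+ (2 ^ m) = 1.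
    apply/rootm; split; last by exists k.
    by apply/(dsetE _ Ha); rewrite mon_scalar -gE' gE; apply/dsetE.
  have [i cE] := prim_rootP zm cm.
  by apply/mapP; exists (i : nat); rewrite ?mem_iota ?add0n //= gE' cE.
have : (z ^+ i) ^+ (2 ^ m) = 1 by rewrite exprAC (prim_expr_order zm) expr1n.
case/rootm => az [k zk]; split; last by exists (z ^+ i), k.
by rewrite -mon_scalar; apply/dsetE.
Qed.

End Scalars.

(** * Translating the listed family into data (a, w) *)

Section Admissible.
Variable p : nat.
Hypothesis p0 : (0 < p)%N.
Implicit Types (A : mxset p) (a : ('I_p -> CC) -> Prop) (w : CC).

Definition nonconstant a := exists d i j, a d /\ d i != d j.

Lemma invmx_perm (s : 'S_p) : invmx (perm_mx s) = mon (fun=> 1) s^-1 :> 'M[CC]_p.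
Proof.
rewrite -mon_perm invmx_mon; last by move=> i; apply: oner_neq0.
by apply: eq_mon => i; rewrite invr1.
Qed.

Lemma admissible_inv_diag A : admissible_A A ->
  let a d := A (mon d 1) in
  [/\ inv_diag a, is_finite (dset a), nonconstant a & same_set A (dset a)].
Proof.
move=> [[A1 AU AM AV] [l Hl] AD AP [g0 [Ag0 sg0]]] a.
have AdP g : A g -> exists2 d, (forall i, d i != 0) & g = mon d 1.
  move=> /AD [d [nz ->]]; exists (d 0) => //.
  by rewrite -mon_diag perm_mx1 mulmx1.
have anz d : a d -> forall i, d i != 0.
  by move=> /AdP [e nz E] i; have [_ <-] := mon_inj nz (esym E).
have HA : same_set A (dset a).
  move=> g; split=> [Ag|[d ad ->] //]; have [d nz gE] := AdP _ Ag.
  by exists d => //; rewrite /a -gE.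
split=> //.
- split=> //.
  + by move=> d e de; rewrite /a (eq_mon _ de).
  + by rewrite /a mon_scalar.
  + by move=> d e ad ae; have := AM _ _ ad ae; rewrite mon_mul mulg1;
      congr A; apply: eq_mon => i; rewrite perm1.
  + move=> d ad; have := AV _ ad; rewrite invmx_mon; last exact: anz.
    by rewrite invg1; congr A; apply: eq_mon => i; rewrite perm1.
  (* Conjugating by the matrix of t turns d into d composed with the inverse of t, hence the inverse
     here. *)
  + move=> d s ad; have := AP s^-1%g _ ad.
    rewrite invmx_perm -mon_perm !mon_mul invgK mulg1 mulgV.
    by congr A; apply: eq_mon => i; rewrite mul1r mulr1.
- by exists l => g; rewrite -(HA g).
have [d nz gE] := AdP _ Ag0; exists d.
suff /existsP[i /existsP[j dij]] : [exists i, exists j, d i != d j].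
  by exists i, j; rewrite /a -gE.
rewrite -[[exists _, _]]negbK; apply: contra sg0 => /existsPn H.
suff -> : g0 = (d (Ordinal p0))%:M by apply: scalar_mx_is_scalar.
rewrite gE -mon_scalar; apply: eq_mon => i.
by have /existsPn/(_ (Ordinal p0)) := H i; rewrite negbK => /eqP.
Qed.

Lemma dset_admissible a : inv_diag a -> is_finite (dset a) -> nonconstant a ->
  admissible_A (dset a).
Proof.
move=> Ha Hf [d0 [i0 [j0 [ad0 dij]]]]; split=> //.
- split.
  + by exists (fun=> 1); [apply: (inv_one Ha) | rewrite mon_scalar].
  + by move=> _ [d ad ->]; apply: mon_unit; apply: (inv_nz Ha ad).
  + move=> _ _ [d ad ->] [e ae ->]; exists (fun i => d i * e i).
      exact: (inv_mul Ha ad ae).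
    by rewrite mon_mul mulg1; apply: eq_mon => i; rewrite perm1.
  + move=> _ [d ad ->]; exists (fun i => (d i)^-1); first exact: (inv_inv Ha ad).
    rewrite invmx_mon; last by apply: (inv_nz Ha ad).
    by rewrite invg1; apply: eq_mon => i; rewrite perm1.
- move=> _ [d ad ->]; exists (\row_i d i); split=> [i|].
    by rewrite mxE; apply: (inv_nz Ha ad).
  rewrite -[RHS]mulmx1 -perm_mx1 mon_diag; apply: eq_mon => i; by rewrite mxE.
- move=> s _ [d ad ->]; exists (fun i => d (s^-1%g i)); first exact: (inv_perm Ha _ ad).
  rewrite invmx_perm -mon_perm !mon_mul mulg1 mulVg.
  by apply: eq_mon => i; rewrite mul1r mulr1.
exists (mon d0 1); split; first by exists d0.
apply: contra dij => /is_scalar_mxP[c]; rewrite -mon_scalar.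
by case/(mon_inj (inv_nz Ha ad0)) => _ E; rewrite !E.
Qed.

(** Intrinsic parameters of the listed groups: w is any scalar of 2-power order with square in a,
    instead of the specific values 1 and z. *)
Definition Rdata a w k := [/\ inv_diag a, is_finite (dset a), nonconstant a,
  a (fun=> w ^+ 2) & w ^+ (2 ^ k) = 1].

Lemma Rdata_neq0 a w k : Rdata a w k -> w != 0.
Proof.
case=> _ _ _ _ wk; apply/eqP => w0; move/eqP: wk.
by rewrite w0 expr0n expn_eq0 /= eq_sym oner_eq0.
Qed.

End Admissible.

Lemma eq_has_card (p : nat) (A B : mxset p) m :
  same_set A B -> has_card A m -> has_card B m.
Proof.
move=> AB [l [ul sl Hl]]; exists l; split=> // g.
by rewrite -(AB g).
Qed.

Lemma same_set_trans (p : nat) (A B C : mxset p) :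
  same_set A B -> same_set B C -> same_set A C.
Proof. by move=> AB BC g; rewrite (AB g). Qed.

Lemma same_set_sym (p : nat) (A B : mxset p) : same_set A B -> same_set B A.
Proof. by move=> AB g; rewrite (AB g). Qed.

(** The scalars of 2-power order in a are the 2^n-th roots of unity, so w^2 in a forces w^(2^n) to
    be 1 or -1. In the first case w is in a and can be replaced by 1; in the second w/z is in a, as
    z^(2^n) = -1, and w can be replaced by z. *)
Lemma in_RstarP (p : nat) (G : mxset p) : prime p -> odd p ->
  in_Rstar G <-> exists a w k, Rdata a w k /\ same_set G (Kset a w).
Proof.
move=> p_pr op; have p0 := prime_gt0 p_pr; split.
  move=> [A [n [HA Hn HG]]].
  have [] := admissible_inv_diag p0 HA; set a := fun d => _.
  move=> Ha af an Aa.
  have AZ : same_set (fun g => A g /\ Z2 g) (fun g => dset a g /\ Z2 g).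
    by move=> g; rewrite (Aa g).
  have Hr := card_Z2_root p0 Ha (eq_has_card AZ Hn).
  case: HG => HG.
    exists a, 1, 0%N; split.
      by split=> //; rewrite expr1n //; apply: (inv_one Ha).
    apply: (same_set_trans HG).
    rewrite -[r_mx p]mulmx1; apply: generated_Kset => //; first exact: oner_neq0.
    by apply: (inv_ext Ha _ (inv_one Ha)) => i; rewrite expr1n.
  set z := zeta (2 ^ n.+1) in HG *.
  have z2 : (z ^+ 2) ^+ (2 ^ n) = 1 by rewrite exprAC zeta_half sqrrN expr1n.
  have [az _] := (Hr _).1 z2.
  have D : Rdata a z n.+1 by split=> //; rewrite expnS exprM.
  exists a, z, n.+1; split=> //; apply: (same_set_trans HG).
  by apply: generated_Kset => //; apply: (Rdata_neq0 D).
move=> [a [w [k [D HG]]]]; have w0 := Rdata_neq0 D.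
case: (D) => Ha af an aw wk.
have [n Hn] := exists_card_Z2 p0 Ha af.
have Hr := card_Z2_root p0 Ha Hn.
exists (dset a), n; split=> //; first exact: dset_admissible.
have w2 : (w ^+ 2) ^+ (2 ^ n) = 1.
  by apply/Hr; split=> //; exists k; rewrite exprAC wk expr1n.
have := w2; rewrite exprAC => /eqP; rewrite sqrf_eq1 => /orP[/eqP wn|/eqP wn].
  left; apply: (same_set_trans HG); apply: same_set_sym.
  have [aw1 _] := (Hr _).1 wn.
  rewrite -[r_mx p]mulmx1.
  apply: same_set_trans (generated_Kset p_pr op Ha _ (oner_neq0 _) _) _ => //.
    by apply: (inv_ext Ha _ (inv_one Ha)) => i; rewrite expr1n.
  apply: Kset_ratio => //; first exact: oner_neq0.
  by apply: (inv_ext Ha _ aw1) => i; rewrite divr1.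
right; apply: (same_set_trans HG); apply: same_set_sym.
set z := zeta (2 ^ n.+1).
have zn : z ^+ (2 ^ n) = -1 by apply: zeta_half.
have z0 : z != 0.
  apply/eqP => z0; move/eqP: zn.
  by rewrite z0 expr0n expn_eq0 /= eq_sym oppr_eq0 oner_eq0.
have z2 : (z ^+ 2) ^+ (2 ^ n) = 1 by rewrite exprAC zn sqrrN expr1n.
have [az _] := (Hr _).1 z2.
have wz : (w / z) ^+ (2 ^ n) = 1 by rewrite expr_div_n wn zn divff // oppr_eq0 oner_eq0.
have [awz _] := (Hr _).1 wz.
apply: same_set_trans (generated_Kset p_pr op Ha _ z0 az) _ => //.
exact: Kset_ratio.
Qed.

Lemma mon_conj (F : fieldType) (n : nat) (v d : 'I_n -> F) (t s : 'S_n) :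
  (forall i, v i != 0) ->
  mon v t *m mon d s *m invmx (mon v t) =
  mon (fun i => v i * d (t i) / v ((t * s * t^-1)%g i)) (t * s * t^-1)%g.
Proof.
move=> vnz; rewrite invmx_mon // !mon_mul; apply: eq_mon => i.
by rewrite !permM.
Qed.

(** * Listed groups are finite, irreducible and monomial with full permutation part *)

Section PartOne.
Variable p : nat.
Hypothesis p3 : (3 <= p)%N.

Lemma monomial_withE (g : 'M[CC]_p) s :
  monomial_with g s <-> exists2 d, (forall i, d i != 0) & g = mon d s.
Proof.
split=> [[d [nz ->]]|[d nz ->]]; first by exists (d 0); rewrite ?mon_diag.
exists (\row_i d i); split=> [i|]; first by rewrite mxE.
by rewrite mon_diag; apply: eq_mon => i; rewrite mxE.
Qed.

Lemma Kset_irreducible_monomial (G : mxset p) a w k :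
  Rdata a w k -> same_set G (Kset a w) ->
  [/\ is_subgroup G, is_finite G, irreducible_set G,
      (forall g, G g -> monomial g) & (forall sigma : 'S_p, in_perm_part G sigma)].
Proof.
move=> D HG; have w0 := Rdata_neq0 D; case: D => Ha af [d0 [i0 [j0 [ad0 dij]]]] aw _.
have HX := signed_mon_group Ha w0 aw.
have [K1 KU KM KV] := mxof_subgroup HX.
split.
- split; first by apply/HG.
  + by move=> g /HG; apply: KU.
  + by move=> g h /HG Kg /HG Kh; apply/HG; apply: KM.
  + by move=> g /HG Kg; apply/HG; apply: KV.
- have [l Hl] := Kset_finite Ha w0 af.
  by exists l => g; rewrite (HG g).
- move=> U HU; apply: (mon_irreducible p3 HX) => [|g Kg]; last by apply/HU/HG.
  by exists d0, i0, j0; split=> //; apply/signed_diag.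
- move=> g /HG [d [s [Xd ->]]]; exists s; apply/monomial_withE.
  by exists d => //; apply: (mg_nz HX Xd).
- move=> s; have [d Xd] := mg_full HX s; exists (mon d s); split.
    by apply/HG; exists d, s.
  by apply/monomial_withE; exists d => //; apply: (mg_nz HX Xd).
Qed.

End PartOne.

(** * Every group of the given kind is conjugate to a listed one *)

Section PartTwo.
Variable p : nat.
Hypothesis p5 : (5 <= p)%N.
Variable G : mxset p.
Hypothesis Gsub : is_subgroup G.
Hypothesis Gmon : forall g, G g -> monomial g.
Hypothesis Gfull : forall s : 'S_p, in_perm_part G s.

Definition mon_in d s := G (mon d s).

Lemma mon_in_mon_group : mon_group mon_in.
Proof.
have [G1 GU GM GV] := Gsub.
have nz d s : mon_in d s -> forall i, d i != 0.
  move=> /Gmon [t /monomial_withE [e enz E]] i.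
  by have [_ <-] := mon_inj enz (esym E).
split=> //.
- by move=> d e s de; rewrite /mon_in (eq_mon _ de).
- by move=> d s e t Gd Ge; rewrite /mon_in -mon_mul; apply: GM.
- by move=> d s Gd; rewrite /mon_in -invmx_mon; [apply: GV | apply: nz Gd].
- move=> s; have [g [Gg /monomial_withE [d _ E]]] := Gfull s.
  by exists d; rewrite /mon_in -E.
Qed.

Lemma dset_diag_part_finite : is_finite G -> is_finite (dset (diag_part mon_in)).
Proof.
move=> [l Hl]; exists [seq g : 'M[CC]_p <- l | g == diag_mx (\row_i g i i)].
move=> g; rewrite mem_filter.
have E : diag_mx (\row_i g i i) = mon (fun i => g i i) 1.
  rewrite -[LHS]mulmx1 -perm_mx1 mon_diag; by apply: eq_mon => i; rewrite mxE.
split=> [[d ad ->]|/andP[/eqP gE /Hl Gg]].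
  apply/andP; split; last exact/Hl.
  apply/eqP/esym; rewrite -[LHS]mulmx1 -perm_mx1 mon_diag.
  by apply: eq_mon => i; rewrite !mxE perm1 eqxx mulr1n.
by exists (fun i => g i i); rewrite /diag_part /mon_in -E -gE.
Qed.

(** Take w to the power q, the odd part of the number of scalars in a: it differs from w by a power
    of w^2, and what is left of its order is a power of 2. *)
Lemma odd_power_of_order2 (a : ('I_p -> CC) -> Prop) (w : CC) :
  inv_diag a -> is_finite (dset a) -> w != 0 ->
  a (fun=> w ^+ 2) -> exists w' k, [/\ a (fun=> w' / w), a (fun=> w' ^+ 2) &
    w' ^+ (2 ^ k) = 1 :> CC].
Proof.
move=> Ha af w0 aw.
have [C [sC memC rootC]] := scalar_list (leq_trans (isT : (0 < 5)%N) p5) Ha af.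
have [q] := pfactor_coprime (isT : prime 2) sC.
rewrite coprime2n => oq CE.
have /memC := aw; rewrite rootC CE => /eqP wC.
exists (w ^+ q), (logn 2 (size C)).+1; split.
- have := inv_pow Ha q./2 aw; apply: (inv_ext Ha) => i.
  by rewrite -exprM mul2n -{2}(odd_double_half q) oq exprS mulrC mulKf.
- by have := inv_pow Ha q aw; apply: (inv_ext Ha) => i; rewrite exprAC.
- by rewrite -wC -!exprM expnS mulnCA.
Qed.

                                                                           
                                                                            
                                     
(** If the diagonal part were scalar, then every element of G would be, up to conjugation by v, a
    scalar times a permutation matrix, and so would stabilise the line that corresponds to the
    all-ones vector. *)
Lemma irreducible_nonconstant (v : 'I_p -> CC) (w : CC) :
  is_finite G -> irreducible_set G ->
  (forall i, v i != 0) -> w != 0 ->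
  (forall s : 'S_p, rescale mon_in v (fun=> w ^+ (s : bool)) s) ->
  nonconstant (diag_part mon_in).
Proof.
move=> Gfin Girr vnz w0 HX.
have [l Hl] := dset_diag_part_finite Gfin.
have p0 : (0 < p)%N by exact: leq_trans p5.
pose o := Ordinal p0.
case: (boolP (has (fun g : 'M_p => ~~ is_scalar_mx g) l)) => [/hasP[g /Hl [d ad ->] ns]|].
  exists d.
  suff /existsP[i /existsP[j dij]] : [exists i, exists j, d i != d j].
    by exists i, j.
  rewrite -[[exists _, _]]negbK; apply: contra ns => /existsPn H.
  suff -> : mon d 1 = (d o)%:M by apply: scalar_mx_is_scalar.
  rewrite -mon_scalar; apply: eq_mon => i.
  by have /existsPn/(_ o) := H i; rewrite negbK => /eqP.
rewrite -all_predC => /allP Hscal.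
have HG := mon_in_mon_group; have HR := rescale_mon_group HG vnz.
have const d : diag_part mon_in d -> forall i, d i = d o.
  move=> ad i; have /Hscal : mon d 1 \in l by apply/Hl; exists d.
  rewrite /= negbK => /is_scalar_mxP[c]; rewrite -mon_scalar.
  by case/(mon_inj (mg_nz HG ad)) => _ E; rewrite !E.
(* The row of the v i^-1 is the all-ones row transported by v, a common eigenvector; all rows of [U]
   equal it, so [U] has rank at most 1. *)
pose u : 'rV[CC]_p := \row_i (v i)^-1.
pose U : 'M[CC]_p := const_mx 1 *m u.
have UE : U = \matrix_(i, j) (v j)^-1.
  by apply/matrixP => i j; rewrite !mxE big_ord1 !mxE mul1r.
have HU g : G g -> (U *m g <= U)%MS.
  move=> Gg; have [s /monomial_withE [e enz gE]] := Gmon Gg.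
  have Re : rescale mon_in v (fun i => e i * v (s i) / v i) s.
    rewrite /rescale /mon_in; rewrite gE in Gg.
    by apply: (mg_ext HG _ Gg) => i; field; rewrite !vnz.
  have /(rescale_diag HG _ vnz)/const C := mg_ratio HR Re (HX s).
  pose c := e o * v (s o) / v o / w ^+ (s : bool); rewrite -/c in C.
  have -> : U *m g = (c * w ^+ (s : bool)) *: U.
    rewrite UE; apply/matrixP => i j; rewrite !mxE (bigD1 (s^-1%g j)) //= big1 ?addr0.
      rewrite gE !mxE permKV eqxx mulr1n -(C (s^-1%g j)) permKV.
      have W0 : w ^+ (s : bool) != 0 by rewrite expf_neq0.
      by rewrite divfK // [RHS]mulrAC mulfK // mulrC.
    move=> k kj; rewrite gE !mxE; case: eqP => [E|_]; last by rewrite mulr0n mulr0.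
    by move: kj; rewrite -E permK eqxx.
  exact: scalemx_sub.
have [U0|Ufull] := Girr _ HU.
  move/matrixP: U0 => /(_ o o); rewrite UE !mxE => /eqP.
  by rewrite invr_eq0 (negbTE (vnz o)).
have : (p <= 1)%N.
  rewrite -(eqP Ufull); apply: leq_trans (mxrankM_maxr _ _) _; exact: rank_leq_row.
by rewrite leqNgt (leq_trans _ p5).
Qed.

Lemma conjugate_to_Kset : odd p -> is_finite G -> irreducible_set G ->
  exists a w k (H : mxset p), [/\ Rdata a w k, same_set H (Kset a w) & gl_conjugate G H].
Proof.
move=> op Gfin Girr.
have HX := mon_in_mon_group.
have [v [w [vnz w0 Hw]]] := mon_group_split p5 HX op.
have HR := rescale_mon_group HX vnz.
have Ha := diag_part_inv_diag HX.
have af := dset_diag_part_finite Gfin.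
(* Square the lift of a transposition with scalar diagonal w. *)
have aw : diag_part mon_in (fun=> w ^+ 2).
  pose i : 'I_p := Ordinal (leq_trans (isT : (0 < 5)%N) p5).
  pose j : 'I_p := Ordinal (leq_trans (isT : (1 < 5)%N) p5).
  have ij : i != j by [].
  have := Hw (tperm i j); rewrite odd_tperm ij => Xt.
  have := mg_mul HR Xt Xt; rewrite tperm2 => /(rescale_diag HX _ vnz).
  by apply: (inv_ext Ha) => k; rewrite -expr2.
have an := irreducible_nonconstant Gfin Girr vnz w0 Hw.
have [w' [k [aww' aw' wk]]] := odd_power_of_order2 Ha af w0 aw.
have w'0 : w' != 0.
  have := inv_nz Ha aww' (Ordinal (leq_trans (isT : (0 < 5)%N) p5)).
  by apply: contraNneq => ->; rewrite mul0r.
(* The conjugate is built with w, as supplied by the splitting; [Kset_ratio] identifies it with the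
   group for w'. *)
exists (diag_part mon_in), w', k, (Kset (diag_part mon_in) w); split=> //.
  exact: Kset_ratio.
exists (mon v 1); split; first exact: mon_unit.
have conjE d s : G (mon v 1 *m mon d s *m invmx (mon v 1)) <-> rescale mon_in v d s.
  rewrite mon_conj // invg1 mulg1 mul1g.
  by split; apply: (mg_ext HX) => i; rewrite perm1.
move=> h; split=> [[d [s [ad ->]]]|Gh].
  apply/conjE; have := mg_diag_mul HR _ (Hw s) => /(_ (fun i => d i / w ^+ s)) H.
  apply: (mg_ext HR _ (H _)) => [i|]; first by rewrite divfK // expf_neq0.
  exact/(rescale_diag HX).
have [s /monomial_withE [e enz E]] := Gmon Gh.
have hE : h = mon (fun i => (v i)^-1 * e i * v (s i)) s.
  have -> : h = invmx (mon v 1) *m mon e s *m mon v 1.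
    by rewrite -E !mulmxA mulVmx ?mon_unit // mul1mx -mulmxA mulVmx ?mon_unit // mulmx1.
  rewrite invmx_mon // !mon_mul invg1 mul1g mulg1.
  by apply: eq_mon => i; rewrite !perm1.
move: Gh; rewrite hE => /conjE Rh.
do 2!eexists; split; last by [].
by apply/(rescale_diag HX _ vnz); apply: (mg_ratio HR Rh (Hw s)).
Qed.

End PartTwo.

                  

                                                                                 
(** * Conjugate listed groups coincide *)

(** Such an s would have an abelian normal closure. Concretely, if s moves i to j, then commuting
    gives (s^t) j = s ((s^t) i) for all t, and in each case some t violates this. *)
Lemma commute_conjugates_eq1 (n : nat) (s : 'S_n) : (5 <= n)%N ->
  (forall t : 'S_n, (s * s ^ t = s ^ t * s)%g) -> s = 1%g.
Proof.
move=> n5 H; apply/permP => i; rewrite perm1; apply/eqP; apply: contraT => si.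
set j := s i in si; have Hi (t : 'S_n) : (s ^ t)%g j = s ((s ^ t)%g i).
  by move/permP: (H t) => /(_ i); rewrite !permM.
have sji : s j != j by rewrite /j (inj_eq perm_inj).
case: (eqVneq (s j) i) => [sj|sj].
  have [k] := @exists_notin n [:: i; j] (leq_trans (isT : 2 < 5)%N n5).
  rewrite !inE negb_or => /andP[ki kj].
  have ski : s k != i by rewrite -sj (inj_eq perm_inj).
  have skj : s k != j by rewrite /j (inj_eq perm_inj).
  case: (eqVneq (s k) k) => [sk|sk].
    have := Hi (tperm j k).
    have -> : (s ^ tperm j k)%g j = j.
      by have := permJ s (tperm j k) k; rewrite sk tpermR.
    have -> : (s ^ tperm j k)%g i = k.
      by have := permJ s (tperm j k) i; rewrite tpermL tpermD // eq_sym.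
    by move=> jk; rewrite jk sk eqxx in kj.
  have [y] := @exists_notin n [:: i; j; k; s k] n5.
  rewrite !inE !negb_or => /and4P[yi yj yk ysk].
  (* Here s swaps i and j and moves k; this t makes s^t send i to k and j to y, so commuting would
     force y = s k. *)
  have := Hi (tperm j k * tperm (s k) y)%g; set t := (tperm j k * _)%g.
  have ti : t i = i by rewrite permM !tpermD // eq_sym.
  have tj : t j = k by rewrite permM tpermL tpermD // eq_sym.
  have tk : t k = j by rewrite permM tpermR tpermD // eq_sym.
  have tsk : t (s k) = y by rewrite permM (@tpermD _ j k (s k)) 1?eq_sym // tpermL.
  have := permJ s t k; rewrite tk tsk => ->.
  have := permJ s t i; rewrite ti -/j tj => -> ysk'.
  by rewrite ysk' eqxx in ysk.
have [k] := @exists_notin n [:: i; j; s j] (leq_trans (isT : 3 < 5)%N n5).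
rewrite !inE !negb_or => /and3P[ki kj ksj].
(* This t fixes i and j, so s^t still sends i to j but sends j to k instead of s j. *)
have := Hi (tperm (s j) k); set t := tperm _ _.
have ti : t i = i by rewrite tpermD // eq_sym.
have tj : t j = j by rewrite tpermD // eq_sym.
have := permJ s t j; rewrite tj tpermL => ->.
have := permJ s t i; rewrite ti -/j tj => -> E.
by rewrite E eqxx in ksj.
Qed.

Section PartThree.
Variable p : nat.
Hypothesis p5 : (5 <= p)%N.

                                                                              
                 
(** The diagonal part of Y is abelian and normal, so the image d s of a diagonal element commutes
    with its conjugates by lifts f t of arbitrary t. Hence s commutes with all its conjugates, and
    [commute_conjugates_eq1] applies. *)
Lemma conj_diag_part (X Y : ('I_p -> CC) -> 'S_p -> Prop)
    (P : 'M[CC]_p) :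
  mon_group X -> mon_group Y -> P \in unitmx ->
  (forall h, mxof Y h <-> mxof X (P *m h *m invmx P)) ->
  forall e, diag_part Y e ->
    exists2 d, diag_part X d & P *m mon e 1 = mon d 1 *m P.
Proof.
move=> HX HY Pu HP e Ye.
have : mxof Y (mon e 1) by exists e, 1%g.
move=> /HP [d [s [Xd E]]].
have E' : P *m mon e 1 = mon d s *m P by rewrite -E mulmxKV.
suff s1 : s = 1%g by exists d; [move: Xd | move: E']; rewrite s1.
apply: (commute_conjugates_eq1 p5) => t.
have [f Xf] := mg_full HX t.
have [f' [t' [Yf' E2]]] : mxof Y (invmx P *m mon f t *m P).
  apply/HP; rewrite !mulmxA mulmxV // mul1mx -mulmxA mulmxV // mulmx1.
  by exists f, t.
have E2' : mon f t *m P = P *m mon f' t' by rewrite -E2 !mulmxA mulmxV // mul1mx.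
have fnz := mg_nz HX Xf; have f'nz := mg_nz HY Yf'; have dnz := mg_nz HX Xd.
have E3 : invmx (mon f t) *m P = P *m invmx (mon f' t').
  apply: (can_inj (mulKmx (mon_unit t fnz))).
  by rewrite mulmxA mulmxV ?mon_unit // mul1mx mulmxA E2'
    -mulmxA mulmxV ?mon_unit // mulmx1.
pose h := invmx (mon f' t') *m mon e 1 *m mon f' t'.
have [c hE] : exists c, h = mon c 1.
  rewrite /h invmx_mon // !mon_mul mulg1 mulVg; by eexists.
pose g := invmx (mon f t) *m mon d s *m mon f t.
have gP : g *m P = P *m h.
  by rewrite /g /h -mulmxA E2' !mulmxA -(mulmxA _ (mon d s)) -E' mulmxA E3.
have [q gE] : exists q, g = mon q (s ^ t)%g.
  by rewrite /g invmx_mon // !mon_mul /conjg mulgA; eexists.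
have gu : g \in unitmx by rewrite !unitmx_mul unitmx_inv !mon_unit.
clearbody g h.
(* Both sides correspond under P to products of the diagonal matrices [mon e 1] and [h], which
   commute. *)
have C : mon d s *m g = g *m mon d s.
  apply: (can_inj (mulmxK Pu)).
  rewrite -!mulmxA gP -E' !mulmxA gP -E' -!mulmxA hE !mon_mul mulg1; congr (_ *m _).
  by apply: eq_mon => i; rewrite !perm1 mulrC.
have qnz : forall i, q i != 0.
  move=> i; apply/negP => /eqP q0.
  have : (row i g) *m invmx g = 0.
    suff -> : row i g = 0 by rewrite mul0mx.
    by apply/rowP => j; rewrite gE !mxE q0 mul0rn.
  rewrite -row_mul mulmxV // => /rowP /(_ i); rewrite !mxE eqxx => /eqP.
  by rewrite oner_eq0.
move: C; rewrite gE !mon_mul => /mon_inj [] // i.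
by rewrite mulf_neq0.
Qed.

                                                                             
                                            
(** The relation says e j = d i wherever P i j is nonzero. Two nonzero entries in one row, at j and
    j', would force a spike at j and a third index k to take equal values x and 1 at j and j'. So
    each row has at most one nonzero entry, and invertibility gives each column at least one. *)
Lemma conj_diag_monomial (a b : ('I_p -> CC) -> Prop) (P : 'M[CC]_p) :
  inv_diag b -> nonconstant b -> P \in unitmx ->
  (forall e, b e -> exists2 d, a d & P *m mon e 1 = mon d 1 *m P) ->
  exists v t, (forall i, v i != 0) /\ P = mon v t.
Proof.
move=> Hb [d0 [i0 [j0 [bd0 dij]]]] Pu HP.
have d0nz := inv_nz Hb bd0.
have ij0 : i0 != j0 by apply: contraNneq dij => ->.
have := spikes_ratio Hb bd0 ij0; set x := _ / _ => Ex.
have x1 : x != 1.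
  by apply: contraNneq dij => x1; rewrite -[d0 i0](divfK (d0nz j0)) -/x x1 mul1r.
have ME e (i j : 'I_p) : (P *m mon e 1) i j = P i j * e j.
  rewrite mxE (bigD1 j) //= big1 ?addr0; first by rewrite mxE perm1 eqxx mulr1n.
  by move=> q qm; rewrite mxE perm1 (negbTE qm) mulr0n mulr0.
have ME' e (i j : 'I_p) : (mon e 1 *m P) i j = e i * P i j.
  rewrite mxE (bigD1 i) //= big1 ?addr0; first by rewrite mxE perm1 eqxx mulr1n.
  by move=> q qm; rewrite mxE perm1 eq_sym (negbTE qm) mulr0n mul0r.
have uniq_col i j j' : P i j != 0 -> P i j' != 0 -> j = j'.
  move=> Pj Pj'; apply/eqP; apply: contraT => jj'.
  have [k] := @exists_notin p [:: j; j'] (leq_trans (isT : 2 < 5)%N p5).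
  rewrite !inE negb_or => /andP[kj kj'].
  have jk : j != k by rewrite eq_sym.
  have [d _ /matrixP E] := HP _ (Ex j k jk).
  move: (E i j) (E i j'); rewrite !ME !ME' /spike eqxx.
  rewrite eq_sym (negbTE jj') eq_sym (negbTE kj').
  rewrite mulrC => /(mulIf Pj) <-; rewrite mulrC => /(mulIf Pj') x1'.
  by rewrite -x1' eqxx in x1.
have ex_row j : exists i, P i j != 0.
  apply/existsP; rewrite -[[exists _, _]]negbK; apply/negP => /existsPn H.
  have : invmx P *m col j P = 0.
    suff -> : col j P = 0 by rewrite mulmx0.
    by apply/colP => i; rewrite !mxE; have := H i; rewrite negbK => /eqP.
  rewrite colE mulKmx // => /colP /(_ j); rewrite !mxE !eqxx => /eqP.
  by rewrite oner_eq0.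
have [f Hf] := fin_all_exists ex_row.
have f_inj : injective f.
  by move=> j j' ff; apply: (uniq_col (f j)) => //; rewrite ff.
pose t := ((perm f_inj)^-1)%g.
have Pt i : P i (t i) != 0.
  by have := Hf (t i); rewrite -(permE f_inj) /t permKV.
exists (fun i => P i (t i)), t; split=> //.
apply/matrixP => i j; rewrite mxE; case: eqP => [->|ne]; first by rewrite mulr1n.
rewrite mulr0n; apply/eqP; apply: contraT => Pij.
by case: ne; apply: (uniq_col i).
Qed.

(** Conjugation by a monomial matrix merely permutes the entries of a diagonal one, and a is closed
    under that. *)
Lemma conj_mon_diag_sub (a b : ('I_p -> CC) -> Prop) (P : 'M[CC]_p) :
  inv_diag a -> inv_diag b -> nonconstant b -> P \in unitmx ->
  (forall e, b e -> exists2 d, a d & P *m mon e 1 = mon d 1 *m P) ->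
  forall e, b e -> a e.
Proof.
move=> Ha Hb bn Pu HP e be.
have [v [t [vnz PE]]] := conj_diag_monomial Hb bn Pu HP.
have [d ad] := HP _ be; rewrite PE !mon_mul => E.
have nz i : v i * e (t i) != 0 by rewrite mulf_neq0 // (inv_nz Hb be).
have [_ {}E] := mon_inj nz E.
apply: (inv_ext Ha _ (inv_perm Ha t^-1%g ad)) => i.
have := E (t^-1%g i); rewrite permKV perm1 mulrC => H.
by rewrite (mulIf (vnz _) H).
Qed.

Lemma gl_conjugate_Kset (a b : ('I_p -> CC) -> Prop) (w w' : CC) k k' :
  Rdata a w k -> Rdata b w' k' -> gl_conjugate (Kset a w) (Kset b w') ->
  same_set (Kset a w) (Kset b w').
Proof.
move=> Da Db [P [Pu HP]].
have w0 := Rdata_neq0 Da; have w'0 := Rdata_neq0 Db.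
case: Da => Ha _ an aw _; case: Db => Hb _ bn bw _.
have HX := signed_mon_group Ha w0 aw; have HY := signed_mon_group Hb w'0 bw.
have ba : forall e, b e -> exists2 d, a d & P *m mon e 1 = mon d 1 *m P.
  move=> e /(signed_diag w' _ Hb) be.
  have [d ad E] := conj_diag_part HX HY Pu HP be.
  by exists d => //; apply/(signed_diag w).
have ab : forall e, a e -> exists2 d, b d & invmx P *m mon e 1 = mon d 1 *m invmx P.
  move=> e /(signed_diag w _ Ha) ae.
  have Pu' : invmx P \in unitmx by rewrite unitmx_inv.
  have HP' h : mxof (signed a w) h <->
      mxof (signed b w') (invmx P *m h *m invmx (invmx P)).
    rewrite invmxK; apply: iff_sym; apply: (iff_trans (HP _)).
    by rewrite !mulmxA mulmxV // mul1mx -mulmxA mulmxV // mulmx1.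
  have [d bd E] := conj_diag_part HY HX Pu' HP' ae.
  by exists d => //; apply/(signed_diag w').
have basub := conj_mon_diag_sub Ha Hb bn Pu ba.
have absub := conj_mon_diag_sub Hb Ha an (etrans (unitmx_inv P) Pu) ab.
have [v [t [vnz PE]]] := conj_diag_monomial Hb bn Pu ba.
have p2 : (2 <= p)%N by exact: leq_trans p5.
pose o : 'I_p := Ordinal (ltnW p2); pose o' : 'I_p := Ordinal p2.
have oo' : o != o' by [].
have Ht : Kset b w' (mon (fun=> w') (tperm o o')).
  exists (fun=> w'), (tperm o o'); split=> //; rewrite /signed odd_tperm oo'.
  by apply: (inv_ext Hb _ (inv_one Hb)) => i; rewrite divff.
(* The image of w' times a transposition has diagonal w'/w relative to w, except for extra factors v
   i / v j and its inverse at the two moved places. Comparison with a fixed place m shows that this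
   ratio is in E, so dividing by the corresponding spike leaves the constant w'/w. *)
have aww' : a (fun=> w' / w).
  move/HP: Ht; rewrite PE mon_conj //.
  have -> : (t * tperm o o' * t^-1 = tperm (t^-1 o) (t^-1 o'))%g.
    by rewrite -tpermJ conjgE invgK mulgA.
  set i := t^-1%g o; set j := t^-1%g o'.
  have ij : i != j by rewrite (inj_eq perm_inj).
  move/(mxofE _ _ HX); rewrite /signed odd_tperm ij expr1.
  set f := (fun _ => _) => af.
  have [m] := @exists_notin p [:: i; j] (leq_trans (isT : 2 < 5)%N p5).
  rewrite !inE negb_or => /andP[mi mj].
  have im : i != m by rewrite eq_sym.
  have jm : j != m by rewrite eq_sym.
  have := spikes_ratio Ha af im.
  have -> : f i / f m = v i / v j.
    by rewrite /f tpermL tpermD //; field; rewrite !vnz w0 w'0.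
  move=> /(_ i j ij) /(inv_div Ha af); apply: (inv_ext Ha) => q.
  rewrite /f /spike; case: tpermP => [->|->|/eqP qi /eqP qj].
  - by rewrite eqxx; field; rewrite !vnz w0.
  - by rewrite eq_sym (negbTE ij) eqxx; field; rewrite !vnz w0.
  - by rewrite (negbTE qi) (negbTE qj); field; rewrite !vnz w0.
apply: same_set_trans (Kset_ratio Ha w0 w'0 aww') _ => g.
by split=> -[d [s [H ->]]]; exists d, s; split=> //; [apply: absub | apply: basub].
Qed.

End PartThree.

Lemma gl_conjugate_same_set (p : nat) (G G' H H' : mxset p) :
  same_set G G' -> same_set H H' -> gl_conjugate G H -> gl_conjugate G' H'.
Proof.
move=> GG' HH' [P [Pu HP]]; exists P; split=> // h.
by rewrite -(HH' h) HP (GG' _).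
Qed.

Theorem theorem7p9 (p : nat) : prime p -> (5 <= p)%N ->
  (forall G : mxset p, in_Rstar G ->
     [/\ is_subgroup G, is_finite G, irreducible_set G,
         (forall g, G g -> monomial g) &
         (forall sigma : 'S_p, in_perm_part G sigma)]) /\
  (forall G : mxset p,
     is_subgroup G -> is_finite G -> irreducible_set G ->
     (forall g, G g -> monomial g) ->
     (forall sigma : 'S_p, in_perm_part G sigma) ->
     exists H : mxset p, in_Rstar H /\ gl_conjugate G H) /\
  (forall G H : mxset p, in_Rstar G -> in_Rstar H ->
     gl_conjugate G H -> same_set G H).
Proof.
move=> p_pr p5.
have op : odd p by case: (even_prime p_pr) p5 => // ->.
have p3 : (3 <= p)%N by apply: leq_trans p5.
split; [|split].
- move=> G /(in_RstarP _ p_pr op) [a [w [k [D HG]]]].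
  exact: (Kset_irreducible_monomial p3 D HG).
- move=> G Gsub Gfin Girr Gmon Gfull.
  have [a [w [k [H [D HK GH]]]]] := conjugate_to_Kset p5 Gsub Gmon Gfull op Gfin Girr.
  by exists H; split=> //; apply/in_RstarP => //; exists a, w, k.
move=> G H /(in_RstarP _ p_pr op) [a [w [k [Da HG]]]].
move=> /(in_RstarP _ p_pr op) [b [w' [k' [Db HH]]]] GH.
apply: (same_set_trans HG); apply: same_set_trans _ (same_set_sym HH).
by apply: (gl_conjugate_Kset p5 Da Db); apply: gl_conjugate_same_set GH.
Qed.
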